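(* Let $\xi\in\mathbb{R}$ be such that $1,\xi,\xi^3$ are linearly independent over $\mathbb{Q}$, let $\lambda,c>0$ be such that for each sufficiently large real number $X$ there exists a non-zero point $\mathbf{x}\in\mathbb{Z}^3$ with $\|\mathbf{x}\|\le X$ and $L(\mathbf{x})\le cX^{-\lambda}$, and let $(\mathbf{x}_i)_{i\ge1}$ be a sequence of minimal points for $(1,\xi,\xi^3)$. Suppose that $\lambda>2/3$, and let $P,Q$ be relatively prime homogeneous elements of $\mathcal{R}=\mathbb{Q}[T,F,S^2V]$. Then there are only finitely many $i\in I$ such that $P$ and $Q$ both vanish at the point $(T_i,F_i,S_i^2V_i)$.
   Context: For $\mathbf{x}=(x_0,x_1,x_2)\in\mathbb{R}^3$, put $\|\mathbf{x}\|=\max\{|x_0|,|x_1|,|x_2|\}$ and $L(\mathbf{x})=\max\{|x_1-x_0\xi|,|x_2-x_0\xi^3|\}$. A sequence of minimal points for $(1,\xi,\xi^3)$ is a sequence $(\mathbf{x}_i)_{i\ge1}$ of non-zero points of $\mathbb{Z}^3$ such that, with $X_i=\|\mathbf{x}_i\|$ and $L_i=L(\mathbf{x}_i)$: (a) $X_1<X_2<X_3<\cdots$; (b) $1/2>L_1>L_2>L_3>\cdots$; (c) if $L(\mathbf{x})<L_i$ for some $\mathbf{x}\in\mathbb{Z}^3\setminus\{0\}$ and some $i\ge1$, then $\|\mathbf{x}\|\ge X_{i+1}$. $I$ is the set of integers $i\ge2$ such that $\mathbf{x}_{i-1},\mathbf{x}_i,\mathbf{x}_{i+1}$ are linearly independent;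 it is an infinite set, ordered increasingly. For triples of indeterminates $\mathbf{x},\mathbf{y},\mathbf{z}$ put $\varphi(\mathbf{x})=x_0^2x_2-x_1^3$ and $\Phi(\mathbf{x},\mathbf{y},\mathbf{z})=x_0y_0z_2+x_0y_2z_0+x_2y_0z_0-3x_1y_1z_1$, and $$S=\varphi(\mathbf{x}),\quad T=\Phi(\mathbf{x},\mathbf{x},\mathbf{y}),\quad U=\Phi(\mathbf{x},\mathbf{y},\mathbf{y}),\quad V=\varphi(\mathbf{y}),\quad F=T^2-4SU .$$ The ring $\mathcal{R}=\bigoplus_{\ell\ge0}\mathcal{R}_\ell$, where $\mathcal{R}_\ell$ consists of the elements of $\mathbb{Q}[S,T,U,V]$ that are bihomogeneous of bidegree $(2\ell,\ell)$ in $(\mathbf{x},\mathbf{y})$ (and $0$), equals $\mathbb{Q}[T,F,S^2V]$ and is a polynomial ring over $\mathbb{Q}$ in the three variables $T,F,S^2V$ (hence a unique factorization domain), graded with $T,F,S^2V$ homogeneous of degrees $1,2,3$. ''Homogeneous'' refers to this grading and ''relatively prime'' is meant in the ring $\mathcal{R}$. For $i\in I$ with successor $j$ in $I$, $S_i,T_i,U_i,V_i,F_i$ denote the values of $S,T,U,V,F$ at $(\mathbf{x},\mathbf{y})=(\mathbf{x}_i,\mathbf{x}_j)$; elements of $\mathcal{R}$ are evaluated at $(T_i,F_i,S_i^2V_i)$ as polynomials in the variables $T,F,S^2V$. *)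

(* Defs.v *)
From HB Require Import structures.
From mathcomp Require Import all_boot all_order all_algebra.
From mathcomp Require Import mpoly.
From mathcomp Require Import classical_sets cardinality reals exp.
Set Implicit Arguments.
Unset Strict Implicit.
Unset Printing Implicit Defensive.
Import Order.TTheory GRing.Theory Num.Theory.
Local Open Scope ring_scope.

(* Points of K^3 are row vectors; the coordinates x_0, x_1, x_2 of x are
   x 0 0, x 0 1, x 0 2. *)

Definition real_pt (R : realType) (x : 'rV[int]_3) : 'rV[R]_3 :=
  map_mx intr x.

Definition supnorm (R : realType) (x : 'rV[R]_3) : R :=
  Num.max `|x 0 0| (Num.max `|x 0 1| `|x 0 2|).

Definition Lxi (R : realType) (xi : R) (x : 'rV[R]_3) : R :=
  Num.max `|x 0 1 - x 0 0 * xi| `|x 0 2 - x 0 0 * xi ^+ 3|.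

Definition linindep_1_xi_xi3 (R : realType) (xi : R) : Prop :=
  forall a b c : rat,
    ratr a + ratr b * xi + ratr c * xi ^+ 3 = 0 ->
    [/\ a = 0, b = 0 & c = 0].

Definition uniform_approx (R : realType) (xi lambda c : R) : Prop :=
  exists X0 : R, forall X : R, X0 <= X ->
    exists x : 'rV[int]_3,
      [/\ x != 0, supnorm (real_pt R x) <= X &
          Lxi xi (real_pt R x) <= c * X `^ (- lambda)].

(* The sequence is indexed from 1: the value x 0 is unconstrained and unused. *)
Definition minimal_points (R : realType) (xi : R) (x : nat -> 'rV[int]_3) :
    Prop :=
  let X i := supnorm (real_pt R (x i)) in
  let L i := Lxi xi (real_pt R (x i)) in
  [/\ forall i, (1 <= i)%N -> x i != 0,
      forall i, (1 <= i)%N -> X i < X i.+1,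
      L 1%N < 1 / 2 /\ (forall i, (1 <= i)%N -> L i.+1 < L i) &
      forall (i : nat) (z : 'rV[int]_3), (1 <= i)%N -> z != 0 ->
        Lxi xi (real_pt R z) < L i -> X i.+1 <= supnorm (real_pt R z)].

Definition setI3 (R : realType) (x : nat -> 'rV[int]_3) : set nat :=
  [set i | (2 <= i)%N /\
     free [:: real_pt R (x i.-1); real_pt R (x i); real_pt R (x i.+1)]]%classic.

Definition succ_in (A : set nat) (i j : nat) : Prop :=
  [/\ A i, A j, (i < j)%N & forall k, A k -> (i < k)%N -> (j <= k)%N].

Section Forms.
Variable K : comNzRingType.
Implicit Types x y z : 'rV[K]_3.

Definition phi x : K := x 0 0 ^+ 2 * x 0 2 - x 0 1 ^+ 3.

Definition Phi x y z : K :=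
  x 0 0 * y 0 0 * z 0 2 + x 0 0 * y 0 2 * z 0 0 + x 0 2 * y 0 0 * z 0 0
  - 3 * x 0 1 * y 0 1 * z 0 1.

Definition formS x y : K := phi x.
Definition formT x y : K := Phi x x y.
Definition formU x y : K := Phi x y y.
Definition formV x y : K := phi y.
Definition formF x y : K := formT x y ^+ 2 - 4 * formS x y * formU x y.

End Forms.

(* The ring Q[T, F, S^2 V], a polynomial ring in T = 'X_0, F = 'X_1 and
   S^2 V = 'X_2. *)
Notation ringR := {mpoly rat[3]}.

(* mnmwgt gives 'X_i weight i.+1, so T, F, S^2 V have degrees 1, 2, 3. *)
Definition homogeneousR (P : ringR) : Prop :=
  exists d : nat, P \is d.-homog for mnmwgt.

Definition dividesR (D P : ringR) : Prop := exists E : ringR, P = E * D.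

Definition relprimeR (P Q : ringR) : Prop :=
  forall D : ringR, dividesR D P -> dividesR D Q -> D \is a GRing.unit.

(* The value of P at (T, F, S^2 V)(x, y). *)
Definition evalR (P : ringR) (x y : 'rV[int]_3) : rat :=
  let x' := map_mx intr x : 'rV[rat]_3 in
  let y' := map_mx intr y : 'rV[rat]_3 in
  P.@[tnth [tuple formT x' y'; formF x' y'; formS x' y' ^+ 2 * formV x' y']].

(* Main.v *)
From HB Require Import structures.
Require Import Defs.
From mathcomp Require Import all_boot all_order all_algebra.
From mathcomp Require Import mpoly.
From mathcomp Require Import boolp classical_sets cardinality reals exp.
From mathcomp Require Import ring lra zify.
Set Implicit Arguments.
Unset Strict Implicit.
Unset Printing Implicit Defensive.
Import Order.TTheory GRing.Theory Num.Theory.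
Local Open Scope ring_scope.

(** Fix i in I with successor j, write x, y for the two minimal points and
    consider the binary cubic form
      f(s,t) = phi(s x + t y) = S s^3 + T s^2 t + U s t^2 + V t^3.
    The three values T, F, G = S^2 V at which P and Q are evaluated are
    equivalent to the coefficients of the monic cubic X^3 + T X^2 + SU X + S^2 V,
    since SU = (T^2 - F) / 4; so the vanishing of P and Q restricts f to finitely
    many forms up to scaling the variables, while the approximation properties
    of x and y force f to be almost degenerate.  The proof plays these two
    facts against each other.

    Algebra.  As P and Q are coprime and Q[T,F,G] is factorial, eliminating F
    and eliminating T give nonzero polynomials in (T,G) and in (F,G) which
    vanish at the common zeros of P and Q ([eliminate]).  Since P and Q are
    homogeneous, the common zeros with G <> 0 are stable under the scalings
    (t, t^2, t^3), and therefore T^3 / G and F^3 / G^2 take finitely many values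
    ([finite_ratios]).  Consequently a quantity which is homogeneous of weight 6
    is at such a zero either 0 or at least a constant times G^2
    ([weight6_bound]).  This is applied to S^2 disc(f) and to H^3, where
    H = T^2 - 3 S U is the first coefficient of the Hessian of f.

    Size.  Let X_i, L_i be the height and the error of x_i.  From lambda > 2/3
    one gets X_(i+1)^2 L_i^3 -> 0 ([small_eventually]), which governs all the
    estimates.  It implies phi(x_i) <> 0 for large i ([phi_neq0_of_prev]): a rational point of the cuspidal cubic phi = 0 is
    proportional to (q^3, p q^2, p^3), and this makes the previous minimal point
    proportional to it.  It also implies that, after t is rescaled by x_0 / y_0,
    the form f differs little from (s + t)^2 (d s + v t), for some reals d and v,
    where |d| is not small because S is a nonzero integer
    ([forms_near_double]).  The latter form has discriminant 0, so that the
    previous dichotomy leaves only disc(f) = 0, and either H = 0 or H is large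
    ([degenerate_forms]).

    Geometry.  If (a, b, c) is a normal vector of the plane spanned by x and y,
    then disc(f) is proportional to c^3 (4 b^3 + 27 a^2 c)
    ([cubic_disc_wedge]): in the projective plane, the line through x and y
    contains the cusp of the curve phi = 0 or is tangent to the curve at some
    rational point (1, r, r^3).  In the tangent case H is nonzero, and its
    largeness keeps r away from xi ([tangent_far]).  In both cases the line meets the curve at a
    further point, explicitly (b^3, - a b^2, - a^3) or (bc, 3ac, - 4ab), which
    is the one near (1, xi, xi^3).  Since consecutive minimal points between
    x_i and x_j stay in one plane, (a, b, c) may be taken to be the cross
    product of x_i and x_(i+1), whose size is at most a constant times
    X_(i+1) L_i; the integer point just described then has height less than
    X_(i+1) and error less than L_i ([cusp_line_point], [tangent_line_point]),
    against the minimality of the sequence. *)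

(** * Unique factorization in polynomial rings *)

Definition dvdr (R : comNzRingType) (a b : R) : Prop := exists c, b = c * a.

Definition prime_elt (R : comUnitRingType) (p : R) : Prop :=
  [/\ p != 0, p \isn't a GRing.unit &
      forall a b, dvdr p (a * b) -> dvdr p a \/ dvdr p b].

(** Units are kept apart from the list of primes, so that a field is factorial by
    means of empty lists. *)
Definition splits (R : comUnitRingType) (a : R) : Prop :=
  exists u s, [/\ u \is a GRing.unit, forall p, p \in s -> prime_elt p &
                  a = u * \prod_(p <- s) p].

Definition is_factorial (R : comUnitRingType) : Prop :=
  forall a : R, a != 0 -> splits a.

Lemma factorial_field (K : fieldType) : is_factorial K.
Proof.
by move=> a a0; exists a, [::]; split; rewrite ?unitfE // big_nil mulr1.
Qed.

Lemma splits_prime (R : comUnitRingType) (p : R) : prime_elt p -> splits p.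
Proof.
move=> pp; exists 1, [:: p]; split; rewrite ?unitr1 // ?big_seq1 ?mul1r //.
by move=> q; rewrite inE => /eqP ->.
Qed.

Lemma splitsM (R : comUnitRingType) (a b : R) :
  splits a -> splits b -> splits (a * b).
Proof.
move=> [u [s [uu ps ->]]] [v [t [uv pt ->]]].
exists (u * v), (s ++ t); split; first by rewrite unitrMl.
  by move=> p; rewrite mem_cat => /orP[/ps|/pt].
by rewrite big_cat /= mulrACA.
Qed.

Lemma prime_dvd_prod (R : comUnitRingType) (q : R) (s : seq R) :
  prime_elt q -> dvdr q (\prod_(p <- s) p) -> exists2 p, p \in s & dvdr q p.
Proof.
move=> [q0 qu qp]; elim: s => [|p s IH].
  rewrite big_nil => -[c cq]; case/negP: qu.
  by apply/unitrP; exists c; rewrite [q * c]mulrC -cq.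
rewrite big_cons => /qp [qdp|/IH[p' p's]].
  by exists p; rewrite ?mem_head.
by exists p'; rewrite // inE p's orbT.
Qed.

Lemma prime_dvd_unit (R : comUnitRingType) (q u : R) :
  prime_elt q -> u \is a GRing.unit -> ~ dvdr q u.
Proof.
by move=> [_ /negP qu _] uu [c cq]; apply: qu; move: uu; rewrite cq unitrM => /andP[].
Qed.

Section Poly.
Variable R : idomainType.
Implicit Types (f g h : {poly R}) (p q : R).

Lemma prime_dvd_prime p q : prime_elt p -> prime_elt q -> dvdr q p ->
  exists2 w, w \is a GRing.unit & p = w * q.
Proof.
move=> [p0 pu pp] [q0 qu qp] [w pE]; exists w => //.
have [] : dvdr p w \/ dvdr p q by apply: pp; exists 1; rewrite mul1r.
  move=> [w' wE]; case/negP: qu; apply/unitrP; exists w'.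
  suff E : w' * q = 1 by split; rewrite // mulrC.
  by apply: (mulfI p0); rewrite mulr1 [RHS]pE wE mulrCA mulrA.
move=> [w' qE]; apply/unitrP; exists w'.
suff E : w' * w = 1 by split; rewrite // mulrC.
by apply: (mulIf q0); rewrite mul1r -mulrA -pE -qE.
Qed.

(** If a prime p divides f g, it divides the product of the leading coefficients,
    hence one of them; removing the leading term of that factor decreases the
    total size and keeps the divisibility of the product. *)
Lemma prime_polyC p : prime_elt p -> prime_elt p%:P.
Proof.
move=> [p0 pu pp]; split; first by rewrite polyC_eq0.
  by rewrite poly_unitE size_polyC p0 coefC eqxx.
move=> f g; have [n] := ubnP (size f + size g).
elim: n f g => // n IH f g ltn.
have [->|f0] := eqVneq f 0; first by left; exists 0; rewrite mul0r.
have [->|g0] := eqVneq g 0; first by right; exists 0; rewrite mul0r.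
have red f' g' : f' != 0 -> (size f' + size g' <= n)%N ->
    dvdr p%:P (f' * g') -> dvdr p (lead_coef f') ->
    dvdr p%:P f' \/ dvdr p%:P g'.
  move=> f'0 le [k kE] [c cE].
  pose f1 := f' - (c%:P * 'X^((size f').-1)) * p%:P.
  have szf1 : (size f1 < size f')%N.
    rewrite -(prednK (n := size f')) ?lt0n ?size_poly_eq0 // ltnS.
    apply/leq_sizeP => j; rewrite leq_eqVlt /f1 coefB mulrAC -polyCM coefCM coefXn.
    case/orP => [/eqP <-|ltj]; first by rewrite eqxx mulr1 -cE subrr.
    rewrite gtn_eqF // mulr0 subr0 nth_default //.
    by rewrite -(prednK (n := size f')) ?lt0n ?size_poly_eq0.
  have : dvdr p%:P (f1 * g').
    exists (k - (c%:P * 'X^((size f').-1)) * g').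
    by rewrite /f1 mulrBl kE mulrBl mulrAC.
  case/(IH _ _ (leq_trans _ le)).
  - by rewrite ltn_add2r.
  - move=> [m mE]; left; exists (m + c%:P * 'X^((size f').-1)).
    by rewrite mulrDl -mE subrK.
  - by right.
move=> d.
have : dvdr p (lead_coef f * lead_coef g).
  by rewrite -lead_coefM; case: d => k ->; exists (lead_coef k); rewrite lead_coefM lead_coefC.
case/pp; first exact: red.
by move/(red g f g0); rewrite addnC mulrC => h; case: (h ltn d); [right|left].
Qed.

Lemma splits_polyC a : splits a -> splits (a%:P : {poly R}).
Proof.
move=> [u [s [uu ps ->]]]; exists u%:P, (map polyC s); split.
- by rewrite poly_unitE size_polyC coefC eqxx uu andbT; case: (eqVneq u 0) uu => // ->; rewrite unitr0.
- by move=> _ /mapP [p /ps pp ->]; exact: prime_polyC.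
- by rewrite polyCM big_map rmorph_prod.
Qed.

Hypothesis factR : is_factorial R.

Lemma nonunit_prime_dvd a : a != 0 -> a \isn't a GRing.unit ->
  exists2 q : R, prime_elt q & dvdr q a.
Proof.
move=> /factR [u [[|q s] [uu ps ->]]]; first by rewrite big_nil mulr1 uu.
move=> _; exists q; first by apply: ps; rewrite mem_head.
by exists (u * \prod_(p <- s) p); rewrite big_cons; ring.
Qed.

(** A form of Gauss's lemma: the prime factors of the constant a are moved one by
    one into g or into h.  The part e taken from g is recorded, because the new
    factor g' must have the same degree as g. *)
Lemma clear_constant a f g h : a != 0 -> a%:P * f = g * h ->
  exists e g' h', [/\ e != 0, g = e%:P * g' & f = g' * h'].
Proof.
move=> /factR [u [s [uu ps ->]]]; elim: s g h ps => [|p s IH] g h ps.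
  rewrite big_nil mulr1 => E; exists 1, g, (u^-1%:P * h).
  rewrite oner_neq0 mul1r; split => //.
  by rewrite mulrCA -E mulrA -polyCM mulVr // mul1r.
have pp := ps p (mem_head _ _).
have pC0 : p%:P != 0 by case: (prime_polyC pp).
rewrite big_cons mulrCA polyCM -mulrA => E.
have ps' q : q \in s -> prime_elt q by move=> qs; apply: ps; rewrite inE qs orbT.
have [] : dvdr p%:P g \/ dvdr p%:P h.
- by case: (prime_polyC pp) => _ _; apply; rewrite -E mulrC; eexists.
- move=> [g1 gE]; have [|e [g' [h' [e0 g1E fE]]]] := IH g1 h ps'.
    by apply: (mulfI pC0); rewrite E gE; ring.
  exists (p * e), g', h'; split => //; last by rewrite gE g1E polyCM mulrC mulrA.
  by rewrite mulf_neq0 //; case: pp.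
- move=> [h1 hE]; apply: (IH g h1 ps').
  by apply: (mulfI pC0); rewrite E hE; ring.
Qed.

(** Suppose that f divides a b.  If f and a have no common factor of positive
    degree, a Bezout relation shows that f divides a constant multiple of b;
    otherwise their pseudo-gcd is associated to f up to constants, so that f
    divides a constant multiple of a.  In both cases the constant can be removed
    as f is primitive. *)
Lemma primitive_irreducible_prime f : (1 < size f)%N ->
  (forall q : R, prime_elt q -> ~ dvdr q%:P f) ->
  (forall g h, f = g * h -> g \is a GRing.unit \/ h \is a GRing.unit) ->
  prime_elt f.
Proof.
move=> szf prim irr.
have f0 : f != 0 by rewrite -size_poly_gt0; apply: ltn_trans szf.
have cancel_const c b k : c != 0 -> c%:P * b = f * k -> dvdr f b.
  move=> c0 /(clear_constant c0) [e [g' [h' [e0 fE bE]]]].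
  have [eu|/(nonunit_prime_dvd e0) [q /prim nq [m mE]]] := boolP (e \is a GRing.unit).
    exists (h' * e^-1%:P); rewrite fE bE -mulrA [_ * (_ * g')]mulrA -polyCM.
    by rewrite mulVr // mul1r mulrC.
  by case: nq; exists (m%:P * g'); rewrite fE mE polyCM mulrAC.
split=> //; first by rewrite poly_unitE gtn_eqF.
move=> a b [k abE].
have [->|a0] := eqVneq a 0; first by left; exists 0; rewrite mul0r.
have [cop|ncop] := boolP (coprimep f a).
  right; have [[u v] /= /eqpP [[c1 c2] /= /andP[c10 c20] E]] := Bezout_coprimepP _ _ cop.
  apply: (cancel_const c2 _ (c1%:P * (u * b + v * k)) c20).
  have -> : c2%:P = c1%:P * (u * f + v * a) by rewrite mul_polyC E alg_polyC.
  have -> : c1%:P * (u * f + v * a) * b = c1%:P * (u * f * b + v * (a * b)) by ring.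
  by rewrite abE; ring.
left; set g := gcdp f a in ncop *.
have g0 : g != 0 by rewrite gcdp_eq0 negb_and f0.
have szg : (1 < size g)%N.
  by rewrite ltn_neqAle eq_sym size_poly_gt0 g0 andbT; rewrite coprimep_def in ncop.
have [[c k1] /= c0 fE] := Pdiv.Idomain.dvdpP _ _ (dvdp_gcdl f a).
have [[c' k2] /= c'0 aE] := Pdiv.Idomain.dvdpP _ _ (dvdp_gcdr f a).
have [e [g' [h' [e0 gE fE']]]] : exists e g' h',
    [/\ e != 0, g = e%:P * g' & f = g' * h'].
  by apply: (clear_constant c0 (h := k1)); rewrite mul_polyC fE mulrC.
have [|h'u] := irr _ _ fE'.
  rewrite poly_unitE -(size_Cmul g' e0) -gE => /andP[/eqP sz1].
  by rewrite sz1 in szg.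
apply: (cancel_const c' _ (k2 * e%:P * h'^-1) c'0).
rewrite mul_polyC aE -/g gE [f in RHS]fE'.
by rewrite -[g' in LHS]mulr1 -(mulrV h'u); ring.
Qed.

(** Induction on the degree and then on the number of prime factors of the
    leading coefficient: the first decreases when a primitive polynomial is
    reducible, the second when a prime constant is divided out. *)
Lemma factorial_poly : is_factorial {poly R}.
Proof.
move=> f; have [n] := ubnP (size f); elim: n f => // n IHn f ltn f0.
have [szf|szf] := leqP (size f) 1.
  rewrite (size1_polyC szf); apply: splits_polyC; apply: factR.
  by rewrite -polyC_eq0 -(size1_polyC szf).
have [u [s [uu ps lE]]] : splits (lead_coef f) by apply: factR; rewrite lead_coef_eq0.
have [m] := ubnP (size s); elim: m f u s ltn f0 szf uu ps lE => // m IHm f u s ltn f0 szf uu ps lE lem.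
have [[q pq [f' fE]]|prim] := pselect (exists2 q : R, prime_elt q & dvdr q%:P f).
  have q0 : q != 0 by case: pq.
  have szf' : size f = size f' by rewrite fE mulrC size_Cmul.
  have lE' : lead_coef f = lead_coef f' * q by rewrite fE lead_coefM lead_coefC.
  have [p sp qp] : exists2 p, p \in s & dvdr q p.
    have [_ _ qM] := pq; have /qM[] : dvdr q (u * \prod_(p <- s) p).
    - by rewrite -lE lE'; eexists.
    - by move/(prime_dvd_unit pq uu).
    - exact: prime_dvd_prod.
  (* q is associated to p, so the cofactor f' loses one prime of its leading coefficient. *)
  have [w wu pE] := prime_dvd_prime (ps _ sp) pq qp.
  rewrite fE; apply: splitsM; last exact/splits_polyC/splits_prime.
  apply: (IHm f' (u * w) (rem p s)); rewrite -?szf' ?unitrMl //.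
  - by apply: contraNneq f0 => f'0; rewrite fE f'0 mul0r.
  - by move=> r /mem_rem; apply: ps.
  - apply: (mulIf q0); rewrite -lE' lE (perm_big _ (perm_to_rem sp)) big_cons pE /=.
    by ring.
  - by rewrite size_rem // prednK //; case: (s) sp.
have prim' q : prime_elt q -> ~ dvdr q%:P f by move=> pq d; apply: prim; exists q.
have [[g [h [fE gu hu]]]|irr] := pselect (exists g h,
    [/\ f = g * h, g \isn't a GRing.unit & h \isn't a GRing.unit]); last first.
  apply/splits_prime/primitive_irreducible_prime => // g h fE.
  have [gu|gu] := boolP (g \is a GRing.unit); first by left.
  have [hu|hu] := boolP (h \is a GRing.unit); first by right.
  by case: irr; exists g, h.
have big k l : f = k * l -> k \isn't a GRing.unit -> (1 < size k)%N.
  move=> fkl ku; rewrite ltnNge; apply/negP => /size1_polyC kE.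
  have k0 : k`_0 != 0.
    by apply: contraNneq f0 => k0; rewrite fkl kE k0 mul0r.
  have ku0 : k`_0 \isn't a GRing.unit.
    by apply: contra ku => uk; rewrite kE poly_unitE size_polyC k0 coefC eqxx.
  have [q pq [c cE]] := nonunit_prime_dvd k0 ku0.
  by apply: (prim' q pq); exists (c%:P * l); rewrite fkl kE cE polyCM; ring.
have sg := big _ _ fE gu.
have sh : (1 < size h)%N by apply: (big h g); rewrite // mulrC.
have g0 : g != 0 by rewrite -size_poly_gt0 ltnW.
have h0 : h != 0 by rewrite -size_poly_gt0 ltnW.
have szfE : size f = (size g + size h).-1 by rewrite fE size_mul.
by rewrite fE; apply: splitsM; apply: IHn => //; lia.
Qed.

(** The pseudo-gcd of p and q only sees their common factors over the fraction
    field.  If it has positive degree, it has a prime factor of positive degree,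
    and this prime divides p and q themselves because it cannot divide the
    constants introduced by pseudo-division. *)
Lemma bezout_constant (p q : {poly R}) :
  (forall D, dvdr D p -> dvdr D q -> D \is a GRing.unit) ->
  exists u v r, r != 0 /\ u * p + v * q = r%:P.
Proof.
move=> cop.
have [|ncop] := boolP (coprimep p q).
  move=> /Bezout_coprimepP [[u v] /= /eqpP [[c1 c2] /= /andP[c10 c20] E]].
  exists (c1%:P * u), (c1%:P * v), c2; split => //.
  have -> : c2%:P = c1%:P * (u * p + v * q) by rewrite mul_polyC E alg_polyC.
  by ring.
have nX : ('X : {poly R}) \isn't a GRing.unit by rewrite poly_unitE size_polyX.
have g0 : gcdp p q != 0.
  rewrite gcdp_eq0; apply: contra nX => /andP[/eqP p0 /eqP q0].
  by apply: cop; [exists 0; rewrite mul0r|exists 0; rewrite mul0r].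
have szg : (1 < size (gcdp p q))%N.
  by rewrite ltn_neqAle eq_sym size_poly_gt0 g0 andbT; rewrite coprimep_def in ncop.
have [u [s [uu ps gE]]] := factorial_poly g0.
have [D Ds szD] : exists2 D, D \in s & (1 < size D)%N.
  apply: contrapT => nD; move: szg; rewrite gE ltnNge; apply/negP; rewrite negbK.
  have su : size u = 1 by move: uu; rewrite poly_unitE => /andP[/eqP].
  have sM (k l : {poly R}) : (size k <= 1)%N -> (size l <= 1)%N -> (size (k * l)%R <= 1)%N.
    by move=> ? ?; apply: leq_trans (size_polyMleq _ _) _; lia.
  apply: (sM); first by rewrite su.
  rewrite big_seq; apply: (big_ind (fun k : {poly R} => (size k <= 1)%N)) => //.
  - by rewrite size_poly1.
  - by move=> D Ds; have [szD|szD] := leqP (size D) 1; rewrite ?szD //; case: nD; exists D.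
have pD : prime_elt D := ps _ Ds.
have Dg : dvdr D (gcdp p q).
  exists (u * \prod_(k <- rem D s) k).
  by rewrite gE (perm_big _ (perm_to_rem Ds)) big_cons /=; ring.
have D_of k : gcdp p q %| k -> dvdr D k.
  move=> /Pdiv.Idomain.dvdpP[[c l] /= c0 E].
  have [k' gE'] := Dg; have [_ _ DM] := pD.
  have /DM[//|[m mE]] : dvdr D (k * c%:P).
    by exists (l * k'); rewrite mulrC mul_polyC E gE' mulrA.
  have m0 : m != 0 by apply: contraNneq c0 => m0; rewrite -polyC_eq0 mE m0 mul0r.
  have := size_polyC c; rewrite mE c0 size_mul //; last by case: pD.
  by move: m0; rewrite -size_poly_gt0; lia.
by case: pD => _ /negP []; apply: cop; apply: D_of; rewrite (dvdp_gcdl, dvdp_gcdr).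
Qed.
End Poly.

(** * Elimination of one of three variables *)

Section Towers.
Variables (K : fieldType) (S : comNzRingType) (f : {rmorphism K -> S}).

(** Evaluation of polynomials with nested variables, the innermost variable
    being sent to a, the next one to b and the outermost one to c. *)
Definition peval1 (a : S) : {poly K} -> S := horner_eval a \o map_poly f.
HB.instance Definition _ a := GRing.RMorphism.copy (peval1 a) (horner_eval a \o map_poly f).

Definition peval2 (a b : S) : {poly {poly K}} -> S :=
  horner_eval b \o map_poly (peval1 a).
HB.instance Definition _ a b := GRing.RMorphism.copy (peval2 a b) (horner_eval b \o map_poly (peval1 a)).

Definition peval3 (a b c : S) : {poly {poly {poly K}}} -> S :=
  horner_eval c \o map_poly (peval2 a b).
HB.instance Definition _ a b c := GRing.RMorphism.copy (peval3 a b c) (horner_eval c \o map_poly (peval2 a b)).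

Lemma peval1C a k : peval1 a k%:P = f k.
Proof. by rewrite /peval1 /= map_polyC /= /horner_eval hornerC. Qed.
Lemma peval1X a : peval1 a 'X = a.
Proof. by rewrite /peval1 /= map_polyX /horner_eval hornerX. Qed.
Lemma peval2C a b k : peval2 a b k%:P = peval1 a k.
Proof. by rewrite /peval2 /= map_polyC /= /horner_eval hornerC. Qed.
Lemma peval2X a b : peval2 a b 'X = b.
Proof. by rewrite /peval2 /= map_polyX /horner_eval hornerX. Qed.
Lemma peval3C a b c k : peval3 a b c k%:P = peval2 a b k.
Proof. by rewrite /peval3 /= map_polyC /= /horner_eval hornerC. Qed.
Lemma peval3X a b c : peval3 a b c 'X = c.
Proof. by rewrite /peval3 /= map_polyX /horner_eval hornerX. Qed.
End Towers.

Lemma poly_rmorph_ext (A S : comNzRingType) (g g' : {rmorphism {poly A} -> S}) :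
  (forall k, g k%:P = g' k%:P) -> g 'X = g' 'X -> g =1 g'.
Proof.
move=> gC gX; elim/poly_ind => [|p k IH]; first by rewrite !rmorph0.
by rewrite !rmorphD !rmorphM /= IH gC gX.
Qed.

Lemma mpoly_rmorph_ext n (A S : comNzRingType) (g g' : {rmorphism {mpoly A[n]} -> S}) :
  (forall k, g k%:MP = g' k%:MP) -> (forall i, g 'X_i = g' 'X_i) -> g =1 g'.
Proof.
move=> gC gX p; rewrite (mpolyE p) !(rmorph_sum g, rmorph_sum g').
apply: eq_bigr => m _; rewrite -mul_mpolyC !rmorphM gC; congr (_ * _).
rewrite mpolyXE_id !rmorph_prod; apply: eq_bigr => i _.
by rewrite !rmorphXn gX.
Qed.

Lemma peval2_ext (K : fieldType) (S : comNzRingType) (f : {rmorphism K -> S})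
  (g : {rmorphism {poly {poly K}} -> S}) :
  (forall k, g k%:P%:P = f k) ->
  g =1 peval2 f (g 'X%:P) (g 'X).
Proof.
move=> gC; apply: poly_rmorph_ext => [k|]; last exact/esym/peval2X.
rewrite [RHS]peval2C; move: k.
apply: (poly_rmorph_ext (g := g \o polyC)) => [k|]; last exact/esym/peval1X.
by rewrite [RHS]peval1C; exact: gC.
Qed.

(** The variables of index a, b, c become the innermost, middle and outermost
    variable of a tower of univariate polynomial rings; the roles are free
    because different variables have to be eliminated. *)
Section Elim.
Variable K : fieldType.
Variables a b c : 'I_3.
Hypotheses (ab : a != b) (ac : a != c) (bc : b != c).
Hypothesis cover : forall i, [|| i == a, i == b | i == c].

Definition tower_var (i : 'I_3) : {poly {poly {poly K}}} :=
  if i == c then 'X else if i == b then 'X%:P else 'X%:P%:P.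

Definition to_tower : {mpoly K[3]} -> {poly {poly {poly K}}} :=
  mmap (polyC \o polyC \o polyC) tower_var.
HB.instance Definition _ := GRing.RMorphism.copy to_tower (mmap (polyC \o polyC \o polyC) tower_var).

Definition of_tower : {poly {poly {poly K}}} -> {mpoly K[3]} :=
  peval3 (mpolyC 3 (R := K)) 'X_a 'X_b 'X_c.
HB.instance Definition _ := GRing.RMorphism.copy of_tower (peval3 (mpolyC 3 (R := K)) 'X_a 'X_b 'X_c).

Lemma to_towerX i : to_tower 'X_i = tower_var i.
Proof. by rewrite /to_tower mmapX mmap1U. Qed.
Lemma to_towerC k : to_tower k%:MP = k%:P%:P%:P.
Proof. by rewrite /to_tower mmapC. Qed.

Lemma to_towerK : cancel to_tower of_tower.
Proof.
apply: (mpoly_rmorph_ext (g := of_tower \o to_tower) (g' := idfun)) => [k|i] /=.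
  by rewrite to_towerC /of_tower peval3C peval2C peval1C.
rewrite to_towerX /tower_var; have := cover i.
have [-> _|_] := eqVneq i c; first by rewrite /of_tower peval3X.
have [-> _|_] := eqVneq i b; first by rewrite /of_tower peval3C peval2X.
by rewrite !orbF => /eqP ->; rewrite /of_tower peval3C peval2C peval1X.
Qed.

Lemma of_towerK : cancel of_tower to_tower.
Proof.
apply: (poly_rmorph_ext (g := to_tower \o of_tower) (g' := idfun)) => [p|]; last first.
  by rewrite /= /of_tower peval3X to_towerX /tower_var eqxx.
move: p; apply: (poly_rmorph_ext (g := to_tower \o of_tower \o polyC)
  (g' := polyC)) => [p|]; last first.
  by rewrite /= /of_tower peval3C peval2X to_towerX /tower_var (negPf bc) eqxx.
move: p; apply: (poly_rmorph_ext (g := to_tower \o of_tower \o polyC \o polyC)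
  (g' := polyC \o polyC)) => [p|]; last first.
  by rewrite /= /of_tower peval3C peval2C peval1X to_towerX /tower_var (negPf ac) (negPf ab).
by rewrite /= /of_tower peval3C peval2C peval1C to_towerC.
Qed.

Let to_towerM : {morph to_tower : x y / x * y} := rmorphM to_tower.
Let of_towerM : {morph of_tower : x y / x * y} := rmorphM of_tower.
Let of_towerD : {morph of_tower : x y / x + y} := rmorphD of_tower.

(** Coprimality is transported to K[X_a][X_b][X_c], where [bezout_constant]
    applies to polynomials in X_c over the factorial ring K[X_a][X_b].  The
    conclusion concerns points with coordinates in any extension S of K. *)
Lemma eliminate (P Q : {mpoly K[3]}) :
  (forall D, dvdr D P -> dvdr D Q -> D \is a GRing.unit) ->
  exists2 r : {poly {poly K}}, r != 0 &
    forall (S : comNzRingType) (f : {rmorphism K -> S}) (v : 'I_3 -> S),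
      mmap f v P = 0 -> mmap f v Q = 0 -> peval2 f (v a) (v b) r = 0.
Proof.
move=> cop.
have fact2 : is_factorial {poly {poly K}}.
  by apply/factorial_poly/factorial_poly/factorial_field.
have [|u [v [r [r0 E]]]] := bezout_constant fact2 (p := to_tower P) (q := to_tower Q).
  move=> D [E PE] [E' QE].
  have : of_tower D \is a GRing.unit.
    apply: cop; [exists (of_tower E)|exists (of_tower E')].
      by have := congr1 of_tower PE; rewrite to_towerK => ->; exact: of_towerM.
    by have := congr1 of_tower QE; rewrite to_towerK => ->; exact: of_towerM.
  move=> /unitrP [k [kD _]]; apply/unitrP; exists (to_tower k).
  have kD1 : to_tower k * D = 1.
    have := congr1 to_tower kD; rewrite to_towerM of_towerK => ->.
    exact: (rmorph1 to_tower).
  by split; rewrite // mulrC.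
exists r => // S f w P0 Q0.
have E' : of_tower u * P + of_tower v * Q = of_tower r%:P.
  have := congr1 of_tower E; rewrite of_towerD !of_towerM.
  by rewrite !to_towerK.
have /esym := congr1 (mmap f w) E'.
have mM : {morph mmap f w : x y / x * y} := rmorphM (mmap f w).
have mD : {morph mmap f w : x y / x + y} := rmorphD (mmap f w).
rewrite mD !mM P0 Q0 !mulr0 addr0 => rE; rewrite -[RHS]rE.
have := @peval2_ext K S f (mmap f w \o of_tower \o polyC) _ r.
rewrite /= /of_tower !peval3C peval2C peval1X peval2X !mmapX !mmap1U => -> //.
by move=> k; rewrite peval3C peval2C peval1C mmapC.
Qed.
End Elim.

(** * Common zeros of coprime weighted homogeneous polynomials *)

Lemma finite_roots (K : idomainType) (p : {poly K}) : p != 0 ->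
  exists s : seq K, forall x, root p x -> x \in s.
Proof.
have [n] := ubnP (size p); elim: n p => // n IH p szp p0.
have [[a pa]|nroot] := pselect (exists a, root p a); last first.
  by exists [::] => x px; case: nroot; exists x.
have /factor_theorem [q pE] := pa.
have q0 : q != 0 by apply: contraNneq p0 => q0; rewrite pE q0 mul0r.
have [|//|s sP] := IH q.
  by move: szp; rewrite pE size_Mmonic ?monicXsubC // size_XsubC addn2.
exists (a :: s) => x; rewrite pE rootM root_XsubC inE => /orP[/sP ->|->] //.
by rewrite orbT.
Qed.

(** A nonzero polynomial cannot vanish at the cubes of all positive integers. *)
Lemma nonroot_cube (R : realType) (p : {poly R}) : p != 0 ->
  exists2 t : R, 0 < t & ~~ root p (t ^+ 3).
Proof.
move=> p0; apply: contrapT => nt.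
pose s := [seq (n.+1%:R : R) ^+ 3 | n <- iota 0 (size p)].
have := @max_poly_roots _ p s p0; rewrite size_map size_iota ltnn => H.
suff : false by []; apply: H.
  apply/allP => _ /mapP [n _ ->]; apply: contrapT => /negP nr; apply: nt.
  by exists n.+1%:R; rewrite ?ltr0Sn.
rewrite map_inj_uniq ?iota_uniq // => m n /eqP.
by rewrite eqrXn2 ?ler0n // eqr_nat => /eqP [].
Qed.

Lemma cube_root (R : realType) (x : R) : x != 0 -> exists2 g, g != 0 & g ^+ 3 = x.
Proof.
have pos (y : R) : 0 < y -> exists2 g, 0 < g & g ^+ 3 = y.
  move=> y0; exists (y `^ (3^-1)); first exact: powR_gt0.
  by rewrite -powR_mulrn ?powR_ge0 // -powRrM mulVf ?pnatr_eq0 // powRr1 // ltW.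
have [x0|x0|->] := ltrgtP x 0; rewrite ?eqxx // => _.
  have [|g g0 gE] := pos (- x); first by rewrite oppr_gt0.
  by exists (- g); rewrite ?oppr_eq0 ?gt_eqF // exprNn gE -signr_odd /= expr1 mulN1r opprK.
by have [g g0 gE] := pos _ x0; exists g; rewrite // gt_eqF.
Qed.

(** Choose t such that t^3 is not a root of the leading coefficient of r: the
    single equation r(t^3, t^k e) = 0 is then a nontrivial equation in e. *)
Lemma finite_slice (R : realType) (k : nat) (r : {poly {poly rat}}) : r != 0 ->
  exists s : seq R, forall e : R,
    (forall t : R, peval2 (ratr : {rmorphism rat -> R}) (t ^+ 3) (t ^+ k * e) r = 0) -> e \in s.
Proof.
move=> r0; set f := (ratr : {rmorphism rat -> R}).
have l0 : map_poly f (lead_coef r) != 0 by rewrite map_poly_eq0 lead_coef_eq0.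
have [t t0 nt] := nonroot_cube l0.
pose g := map_poly (peval1 f (t ^+ 3)) r.
have g0 : g != 0.
  apply: contra nt => /eqP /(congr1 (fun p : {poly R} => p`_(size r).-1)).
  by rewrite coef0 coef_map /= => E; apply/rootP; exact: E.
have [s sP] := finite_roots g0.
exists [seq x / t ^+ k | x <- s] => e H.
apply/mapP; exists (t ^+ k * e); last by rewrite mulrC mulKf // expf_neq0 // gt_eqF.
by apply/sP/rootP; exact: H.
Qed.

Lemma mmap_ratr (R : realType) (P : {mpoly rat[3]}) (w : 'I_3 -> rat) :
  ratr P.@[w] = mmap (ratr : {rmorphism rat -> R}) (fun i => ratr (w i)) P.
Proof.
rewrite mevalE /mmap rmorph_sum; apply: eq_bigr => m _.
rewrite rmorphM; congr (_ * _); rewrite /mmap1 rmorph_prod; apply: eq_bigr => i _.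
by rewrite rmorphXn.
Qed.

Lemma homogeneous_scale (R : realType) (P : {mpoly rat[3]}) (v : 'I_3 -> R) (t : R) :
  homogeneousR P -> mmap (ratr : {rmorphism rat -> R}) v P = 0 ->
  mmap (ratr : {rmorphism rat -> R}) (fun i => t ^+ i.+1 * v i) P = 0.
Proof.
move=> [d /dhomogP hP] P0; rewrite -[RHS](mulr0 (t ^+ d)) -P0 /mmap mulr_sumr.
rewrite !big_seq; apply: eq_bigr => m /hP <-; rewrite mulrCA; congr (_ * _).
rewrite /mmap1 /mnmwgt -prodrXr -big_split /=; apply: eq_bigr => i _.
by rewrite exprMn -exprM mulnC.
Qed.

(** A real cube root g of G normalises the last coordinate to 1.  As the zeros
    are stable under weighted scaling, the eliminated polynomials vanish along
    the whole curve (t T / g, t^2 F / g^2, t^3), which is the hypothesis of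
    [finite_slice].  The third coordinate, G, is made the innermost variable
    in both eliminations. *)
Lemma finite_ratios (R : realType) (P Q : {mpoly rat[3]}) :
  homogeneousR P -> homogeneousR Q -> relprimeR P Q ->
  exists s1 s2 : seq R, forall (w : 'I_3 -> rat) (g : R),
    P.@[w] = 0 -> Q.@[w] = 0 -> g != 0 -> ratr (w 2) = g ^+ 3 ->
    ratr (w 0) / g \in s1 /\ ratr (w 1) / g ^+ 2 \in s2.
Proof.
move=> hP hQ cop.
have cop' D : dvdr D P -> dvdr D Q -> D \is a GRing.unit by exact: cop.
have [||||r1 r10 r1P] := @eliminate _ 2 0 1 _ _ _ _ P Q cop'; try by [].
  by case => -[|[|[|]]].
have [||||r2 r20 r2P] := @eliminate _ 2 1 0 _ _ _ _ P Q cop'; try by [].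
  by case => -[|[|[|]]].
have [s1 s1P] := finite_slice R 1 r10.
have [s2 s2P] := finite_slice R 2 r20.
exists s1, s2 => w g Pw Qw g0 gE.
pose f := (ratr : {rmorphism rat -> R}).
pose v (i : 'I_3) : R := ratr (w i).
have Pv : mmap f v P = 0 by rewrite -mmap_ratr Pw rmorph0.
have Qv : mmap f v Q = 0 by rewrite -mmap_ratr Qw rmorph0.
(* Scaling the zero by t / g replaces its last coordinate by t^3. *)
have tw (t : R) : t ^+ 3 = (t / g) ^+ 3 * v 2.
  by rewrite /v gE -exprMn divfK.
split.
  apply: s1P => t.
  have := r1P _ f _ (homogeneous_scale (t / g) hP Pv) (homogeneous_scale (t / g) hQ Qv).
  by rewrite -tw /= /v => <-; congr peval2; rewrite !expr1; field.
apply: s2P => t.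
have := r2P _ f _ (homogeneous_scale (t / g) hP Pv) (homogeneous_scale (t / g) hQ Qv).
by rewrite -tw /= /v => <-; congr peval2; field.
Qed.

Lemma lower_bound_nonzero (R : realType) (s : seq R) :
  exists2 k : R, 0 < k & forall x, x \in s -> x = 0 \/ k <= `|x|.
Proof.
elim: s => [|y s [k k0 kP]]; first by exists 1.
have [->|y0] := eqVneq y 0.
  by exists k => // x; rewrite inE => /orP[/eqP ->|/kP //]; left.
exists (Num.min k `|y|) => [|x]; first by rewrite lt_min k0 normr_gt0.
by rewrite inE ge_min => /orP[/eqP ->|/kP [|->]]; rewrite ?lexx ?orbT; [right|left|right].
Qed.

Lemma upper_bound_seq (R : realType) (s : seq R) :
  exists2 k : R, 0 < k & forall x, x \in s -> `|x| <= k.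
Proof.
elim: s => [|y s [k k0 kP]]; first by exists 1.
exists (Num.max k `|y|) => [|x]; first by rewrite lt_max k0.
by rewrite inE le_max => /orP[/eqP ->|/kP ->]; rewrite ?lexx ?orbT.
Qed.

(** With g^3 = G one has N(T,F,G) = g^6 N(T/g, F/g^2, 1), where the last factor
    takes finitely many values, and g^6 = G^2. *)
Lemma weight6_bound (R : realType) (P Q : {mpoly rat[3]}) (N : R -> R -> R -> R) :
  homogeneousR P -> homogeneousR Q -> relprimeR P Q ->
  (forall t a b c, N (t * a) (t ^+ 2 * b) (t ^+ 3 * c) = t ^+ 6 * N a b c) ->
  exists2 k : R, 0 < k & forall w : 'I_3 -> rat,
    P.@[w] = 0 -> Q.@[w] = 0 -> w 2 != 0 ->
    let G : R := ratr (w 2) in let n := N (ratr (w 0)) (ratr (w 1)) G in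
    [/\ n = 0 \/ k * G ^+ 2 <= `|n| & k * (ratr (w 0) : R) ^+ 6 <= G ^+ 2].
Proof.
move=> hP hQ cop hN.
have [s1 [s2 sP]] := finite_ratios R hP hQ cop.
have [k k0 kP] := lower_bound_nonzero [seq N a b 1 | a <- s1, b <- s2].
have [C C0 CP] := upper_bound_seq s1.
have C6 : 0 < C ^+ 6 by rewrite exprn_gt0.
exists (Num.min k (C ^+ 6)^-1); first by rewrite lt_min k0 invr_gt0.
move=> w Pw Qw w2 G n.
have G0 : G != 0 by rewrite fmorph_eq0.
have [g g0 gE] := cube_root G0.
have G2 : G ^+ 2 = g ^+ 6 by rewrite -gE -exprM.
have [a_s b_s] := sP w g Pw Qw g0 (esym gE).
have g6 : 0 <= g ^+ 6 by rewrite (exprM g 3 2) sqr_ge0.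
have nE : n = g ^+ 6 * N (ratr (w 0) / g) (ratr (w 1) / g ^+ 2) 1.
  rewrite -hN mulr1 gE /n; congr (N _ _ _); field; exact: g0.
split.
  have [|E|E] := kP (N (ratr (w 0) / g) (ratr (w 1) / g ^+ 2) 1).
  - by apply/allpairsP; exists (ratr (w 0) / g, ratr (w 1) / g ^+ 2).
  - by left; rewrite nE E mulr0.
  right; rewrite nE normrM G2 (ger0_norm g6) mulrC ler_wpM2l //.
  by apply: le_trans E; rewrite ge_min lexx.
have wE : (ratr (w 0) : R) = g * (ratr (w 0) / g) by rewrite mulrC divfK.
rewrite G2 wE exprMn mulrCA ler_piMr //.
have le6 : (ratr (w 0) / g) ^+ 6 <= C ^+ 6.
  apply: le_trans (ler_norm _) _; rewrite normrX lerXn2r ?nnegrE ?normr_ge0 ?(ltW C0) //.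
  exact: CP.
apply: le_trans (_ : (C ^+ 6)^-1 * (ratr (w 0) / g) ^+ 6 <= _).
  apply: ler_wpM2r; last by rewrite ge_min lexx orbT.
  by rewrite (exprM _ 3 2) sqr_ge0.
by rewrite mulrC ler_pdivrMr // mul1r.
Qed.

(** * Sequences of minimal points *)

Definition rcoord (R : realType) (z : 'rV[int]_3) (k : 'I_3) : R := (z 0 k)%:~R.

Section Points.
Variables (R : realType) (xi : R).
Implicit Types z : 'rV[int]_3.

Lemma ord3P (k : 'I_3) : [\/ k = 0, k = 1 | k = 2].
Proof.
case: k => -[|[|[|//]]] h.
- by constructor 1; apply: val_inj.
- by constructor 2; apply: val_inj.
- by constructor 3; apply: val_inj.
Qed.

Lemma rcoord_le_supnorm z k : `|rcoord R z k| <= supnorm (real_pt R z).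
Proof.
rewrite /supnorm /real_pt !mxE /rcoord !le_max.
by case: (ord3P k) => ->; rewrite lexx ?orbT.
Qed.

Lemma supnorm_lt z B : (supnorm (real_pt R z) < B) =
  [&& `|rcoord R z 0| < B, `|rcoord R z 1| < B & `|rcoord R z 2| < B].
Proof. by rewrite /supnorm /real_pt !mxE /rcoord !gt_max. Qed.

Lemma supnorm_le z B : (supnorm (real_pt R z) <= B) =
  [&& `|rcoord R z 0| <= B, `|rcoord R z 1| <= B & `|rcoord R z 2| <= B].
Proof. by rewrite /supnorm /real_pt !mxE /rcoord !ge_max. Qed.

Lemma Lxi_lt z B : (Lxi xi (real_pt R z) < B) =
  (`|rcoord R z 1 - rcoord R z 0 * xi| < B) && (`|rcoord R z 2 - rcoord R z 0 * xi ^+ 3| < B).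
Proof. by rewrite /Lxi /real_pt !mxE /rcoord gt_max. Qed.

Lemma Lxi_le z B : (Lxi xi (real_pt R z) <= B) =
  (`|rcoord R z 1 - rcoord R z 0 * xi| <= B) && (`|rcoord R z 2 - rcoord R z 0 * xi ^+ 3| <= B).
Proof. by rewrite /Lxi /real_pt !mxE /rcoord ge_max. Qed.

Lemma Lxi_ge0 z : 0 <= Lxi xi (real_pt R z).
Proof. by rewrite /Lxi le_max normr_ge0. Qed.

Lemma norm_int_ge1 (m : int) : m != 0 -> 1 <= `|m%:~R : R|.
Proof. by move=> m0; rewrite -intr_norm ler1z -gtz0_ge1 normr_gt0. Qed.

Lemma norm_int_lt1 (m : int) : `|m%:~R : R| < 1 -> m = 0.
Proof.
by move=> h; apply/eqP; apply: contraTT h => /norm_int_ge1; rewrite -leNgt.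
Qed.

Lemma eq0_coords z : z 0 0 = 0 -> z 0 1 = 0 -> z 0 2 = 0 -> z = 0.
Proof.
by move=> h0 h1 h2; apply/rowP => k; rewrite mxE; case: (ord3P k) => ->.
Qed.

Lemma rcoord0_neq0 z : z != 0 -> Lxi xi (real_pt R z) < 1 -> rcoord R z 0 != 0.
Proof.
move=> z0; rewrite Lxi_lt; apply: contraTneq => c0.
rewrite c0 !mul0r !subr0; apply: contraNN z0 => /andP[/norm_int_lt1 z1 /norm_int_lt1 z2].
apply/eqP/eq0_coords => //; apply/eqP; rewrite -(intr_eq0 R); exact/eqP.
Qed.

Lemma supnorm_le_rcoord0 z : z != 0 -> Lxi xi (real_pt R z) < 1 ->
  supnorm (real_pt R z) <= (2 + `|xi| + `|xi| ^+ 3) * `|rcoord R z 0|.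
Proof.
move=> z0 Lz; have c0 := rcoord0_neq0 z0 Lz.
have a1 : 1 <= `|rcoord R z 0| by apply: norm_int_ge1; rewrite -(intr_eq0 R).
move: Lz; rewrite Lxi_lt => /andP[/ltW h1 /ltW h2].
have x0 := normr_ge0 xi; have x3 : 0 <= `|xi| ^+ 3 by rewrite exprn_ge0.
have b1 : `|rcoord R z 1| <= 1 + `|rcoord R z 0| * `|xi|.
  rewrite -normrM -[rcoord R z 1](subrK (rcoord R z 0 * xi)).
  by apply: le_trans (ler_normD _ _) _; rewrite lerD2r.
have b2 : `|rcoord R z 2| <= 1 + `|rcoord R z 0| * `|xi| ^+ 3.
  rewrite -normrX -normrM -[rcoord R z 2](subrK (rcoord R z 0 * xi ^+ 3)).
  by apply: le_trans (ler_normD _ _) _; rewrite lerD2r.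
have m1 : 0 <= `|rcoord R z 0| * `|xi| by rewrite mulr_ge0.
have m3 : 0 <= `|rcoord R z 0| * `|xi| ^+ 3 by rewrite mulr_ge0.
by rewrite supnorm_le; apply/and3P; split; lra.
Qed.

Lemma supnorm_nat z : exists n : nat, supnorm (real_pt R z) = n%:R.
Proof.
exists (maxn (absz (z 0 0)) (maxn (absz (z 0 1)) (absz (z 0 2)))).
by rewrite /supnorm /real_pt !mxE !natr_max !natr_absz !intr_norm.
Qed.

End Points.

Section Minimal.
Variables (R : realType) (xi : R) (x : nat -> 'rV[int]_3).
Hypothesis hx : minimal_points xi x.
Let X i := supnorm (real_pt R (x i)).
Let L i := Lxi xi (real_pt R (x i)).

Lemma minimal_neq0 i : (0 < i)%N -> x i != 0.
Proof. by case: hx => + _ _ _; apply. Qed.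

Lemma minimal_height_lt i k : (0 < i)%N -> (i < k)%N -> X i < X k.
Proof.
move=> i0; case: hx => _ hX _ _; elim: k => // k IH; rewrite ltnS leq_eqVlt => /orP[/eqP <-|ik].
  exact: hX.
by apply: lt_trans (IH ik) _; apply: hX; apply: leq_trans ik.
Qed.

Lemma minimal_error_lt i k : (0 < i)%N -> (i < k)%N -> L k < L i.
Proof.
move=> i0; case: hx => _ _ [_ hL] _; elim: k => // k IH; rewrite ltnS leq_eqVlt => /orP[/eqP <-|ik].
  exact: hL.
by apply: lt_trans (IH ik); apply: hL; apply: leq_trans ik.
Qed.

Lemma minimal_error_lt1 i : (0 < i)%N -> L i < 1.
Proof.
move=> i0; have [_ _ [L1 _] _] := hx.
apply: le_lt_trans (_ : 1 / 2 < 1); last lra.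
case: i i0 => // -[_|i _]; first exact: ltW.
by apply/ltW/(lt_trans _ L1)/minimal_error_lt.
Qed.

Lemma minimal_error_gt0 i : (0 < i)%N -> 0 < L i.
Proof. by move=> i0; apply: le_lt_trans (Lxi_ge0 _ _) (minimal_error_lt i0 (ltnSn i)). Qed.

Lemma minimal_height_ge i : (0 < i)%N -> i%:R <= X i.
Proof.
elim: i => // -[_ _|i IH _].
  have c0 := rcoord0_neq0 (minimal_neq0 (ltnSn 0)) (minimal_error_lt1 (ltnSn 0)).
  by apply: le_trans (rcoord_le_supnorm R (x 1) 0); apply: norm_int_ge1; rewrite -(intr_eq0 R).
have := minimal_height_lt (ltn0Sn i) (ltnSn i.+1); have := IH (ltn0Sn i).
rewrite /X; have [n ->] := supnorm_nat R (x i.+1); have [m ->] := supnorm_nat R (x i.+2).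
by rewrite ler_nat ltr_nat ler_nat => /leq_ltn_trans h /h.
Qed.

Lemma minimal_contra i z : (0 < i)%N -> z != 0 ->
  Lxi xi (real_pt R z) < L i -> supnorm (real_pt R z) < X i.+1 -> False.
Proof.
by move=> i0 z0 hL; rewrite ltNge; case: hx => _ _ _ /(_ i z i0 z0 hL) ->.
Qed.

(** If x_k is t times x_i, then heights and errors are both multiplied by |t|;
    but the height increases and the error decreases. *)
Lemma minimal_wedge i k : (0 < i)%N -> (i < k)%N ->
  rcoord R (x i) 0 * rcoord R (x k) 1 = rcoord R (x i) 1 * rcoord R (x k) 0 ->
  rcoord R (x i) 0 * rcoord R (x k) 2 = rcoord R (x i) 2 * rcoord R (x k) 0 -> False.
Proof.
move=> i0 ik h1 h2.
have c0 := rcoord0_neq0 (minimal_neq0 i0) (minimal_error_lt1 i0).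
have [t e0] : exists t, rcoord R (x k) 0 = t * rcoord R (x i) 0.
  by exists (rcoord R (x k) 0 / rcoord R (x i) 0); rewrite divfK.
have e1 : rcoord R (x k) 1 = t * rcoord R (x i) 1.
  by apply: (mulfI c0); rewrite h1 e0; ring.
have e2 : rcoord R (x k) 2 = t * rcoord R (x i) 2.
  by apply: (mulfI c0); rewrite h2 e0; ring.
have XE : X k = `|t| * X i.
  rewrite /X /supnorm /real_pt !mxE -!/(rcoord R _ _) e0 e1 e2 !normrM.
  by rewrite -!maxr_pMr.
have LE : L k = `|t| * L i.
  rewrite /L /Lxi /real_pt !mxE -!/(rcoord R _ _) e0 e1 e2 -!mulrA -!mulrBr !normrM.
  by rewrite -maxr_pMr.
have := minimal_height_lt i0 ik; have := minimal_error_lt i0 ik.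
have Xi0 : 0 < X i.
  by apply: lt_le_trans (minimal_height_ge i0); rewrite ltr0n.
have Li0 := minimal_error_gt0 i0.
rewrite XE LE; rewrite gtr_pMl // ltr_pMl // => t1 t2.
by have := lt_trans t1 t2; rewrite ltxx.
Qed.

(** A point of height at most X_(i+1) / 2 has error at least L_i, whence
    L_i <= c (X_(i+1) / 2)^(- lambda); then 2 - 3 lambda < 0. *)
Lemma small_eventually (lambda c : R) :
  0 < c -> uniform_approx xi lambda c -> 2 / 3 < lambda ->
  forall eta : R, 0 < eta -> exists N : nat, forall i, (N <= i)%N ->
    (0 < i)%N /\ X i.+1 ^+ 2 * L i ^+ 3 < eta.
Proof.
move=> c0 [X0 hX0] hl eta eta0.
pose mu := 3 * lambda - 2; have mu0 : 0 < mu by rewrite /mu; lra.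
pose B := (4 * c ^+ 3 / eta) `^ mu^-1.
pose M : R := 2 * (X0 + B + 1 + `|X0|).
exists (Num.Def.truncn M).+1 => i Ni.
have i0 : (0 < i)%N by apply: leq_trans Ni.
split=> //.
have B0 : 0 <= B := powR_ge0 _ _.
have XM : M < X i.+1.
  apply: lt_le_trans (minimal_height_ge (ltn0Sn i)).
  have : 0 <= M by rewrite /M; have := ler_norm (- X0); rewrite normrN; lra.
  move=> M0; apply: lt_le_trans (_ : (Num.Def.truncn M).+1%:R <= _).
    by have := truncn_itv M0 => /andP[].
  by rewrite ler_nat; apply: leq_trans Ni (leqnSn _).
have [Y YE] : exists Y, Y = X i.+1 / 2 by exists (X i.+1 / 2).
have nX0 : - `|X0| <= X0 by rewrite lerNl -normrN ler_norm.
have nX1 : X0 <= `|X0| by exact: ler_norm.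
have nn := normr_ge0 X0.
have [Y0 YB YX] : [/\ 0 < Y, B < Y & X0 <= Y].
  by rewrite YE; move: XM; rewrite /M => XM; split; lra.
have YXi : Y < X i.+1 by move: Y0; rewrite YE; lra.
(* The heights are integers increasing with i, so X_(i+1) / 2 is eventually in
   the range of the approximation hypothesis. *)
have Lle : L i <= c * Y `^ (- lambda).
  have [z [z0 zY zL]] := hX0 Y YX.
  rewrite leNgt; apply/negP => lt; apply: (minimal_contra i0 z0).
    exact: le_lt_trans zL lt.
  exact: le_lt_trans zY YXi.
have XY : X i.+1 = 2 * Y by rewrite YE; field.
have L3 : L i ^+ 3 <= (c * Y `^ (- lambda)) ^+ 3.
  by apply: lerXn2r => //; rewrite nnegrE ?(ltW (minimal_error_gt0 i0)) // mulr_ge0 ?powR_ge0 // ltW.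
apply: le_lt_trans (_ : X i.+1 ^+ 2 * (c * Y `^ (- lambda)) ^+ 3 < _).
  by rewrite ler_wpM2l // sqr_ge0.
have -> : X i.+1 ^+ 2 * (c * Y `^ (- lambda)) ^+ 3 = 4 * c ^+ 3 * Y `^ (- mu).
  rewrite XY !exprMn -[(Y `^ _) ^+ 3]powR_mulrn ?powR_ge0 // -powRrM.
  rewrite -[Y ^+ 2]powR_mulrn ?(ltW Y0) //.
  have -> : - mu = 2%:R + - lambda * 3%:R by rewrite /mu; ring.
  rewrite (@powRD _ Y 2%:R); last by rewrite (gt_eqF Y0) implybT.
  by ring.
have Ymu : 0 < Y `^ mu by apply: powR_gt0.
rewrite powRN ltr_pdivrMr // [eta * _]mulrC -ltr_pdivrMr //.
have -> : 4 * c ^+ 3 / eta = B `^ mu.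
  rewrite /B -powRrM mulVf ?gt_eqF // powRr1 // divr_ge0 ?(ltW eta0) //.
  by rewrite mulr_ge0 // exprn_ge0 // ltW.
by apply: gt0_ltr_powR => //; rewrite nnegrE // ltW.
Qed.

End Minimal.

(** * Minimal points off the cuspidal cubic *)

(** Divide x0 and x1 by their gcd d, obtaining coprime q and p with
    q^2 x2 = d p^3; then q^2 divides d. *)
Lemma cuspidal_cubic_param (x0 x1 x2 : int) : x0 != 0 -> x0 ^+ 2 * x2 = x1 ^+ 3 ->
  exists e q p : int, [/\ x0 = e * q ^+ 3, x1 = e * p * q ^+ 2 & x2 = e * p ^+ 3].
Proof.
move=> x00 E; set d := gcdz x0 x1.
have d0 : d != 0 by rewrite gcdz_eq0 negb_and x00.
have [q qE] := dvdzP (dvdz_gcdl x0 x1); have [p pE] := dvdzP (dvdz_gcdr x0 x1).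
rewrite -/d in qE pE.
have cop : coprimez q p.
  rewrite /coprimez; apply/eqP/(mulIf d0).
  have dE : `|d| = d by rewrite /d /gcdz.
  by rewrite mul1r -{1}dE mulz_gcdl -qE -pE.
have E' : q ^+ 2 * x2 = d * p ^+ 3.
  apply: (mulIf (expf_neq0 2 d0)).
  transitivity (x0 ^+ 2 * x2); first by rewrite qE; ring.
  by rewrite E pE; ring.
have : (q ^+ 2 %| d)%Z.
  rewrite -(@Gauss_dvdzl _ _ (p ^+ 3)) ?coprimezXl ?coprimezXr // -E'.
  exact: dvdz_mulr.
move=> /dvdzP [e eE]; exists e, q, p.
have q0 : q != 0 by apply: contraNneq x00 => q0; rewrite qE q0 mul0r.
split; first by rewrite qE eE; ring.
  by rewrite pE eE; ring.
apply: (mulfI (expf_neq0 2 q0)); rewrite E' eE; ring.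
Qed.

Lemma norm_lt1_cube (R : realType) (B n : R) : 0 <= B -> `|n| <= B -> B ^+ 3 < 1 -> `|n| < 1.
Proof.
move=> B0 nB B3; apply: le_lt_trans nB _.
by rewrite ltNge; apply/negP => B1; move: B3; rewrite ltNge exprn_ege1.
Qed.

Lemma intrXn (R : comNzRingType) (m : int) n : (m ^+ n)%:~R = m%:~R ^+ n :> R.
Proof. exact: rmorphXn. Qed.

Lemma phi_rcoord (R : realType) (z : 'rV[int]_3) :
  (phi z)%:~R = rcoord R z 0 ^+ 2 * rcoord R z 2 - rcoord R z 1 ^+ 3.
Proof. by rewrite /phi /rcoord rmorphB rmorphM !rmorphXn. Qed.

Section PhiNonzero.
Variables (R : realType) (xi : R).

(** Here z is the minimal point before x.  Writing x = e (q^3, p q^2, p^3), the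
    integers z_0 p - z_1 q and z_1 p^2 - z_2 q^2 are bounded by a constant times
    q^2 L(z), hence by a constant times the cube root of X(x)^2 L(z)^3; when
    this is less than 1 they vanish, and z is proportional to x. *)
Lemma phi_neq0_of_prev : exists2 C : R, 0 < C &
  forall x z : 'rV[int]_3, x != 0 ->
  let X := supnorm (real_pt R x) in let L := Lxi xi (real_pt R z) in
  Lxi xi (real_pt R x) <= L -> L < 1 -> supnorm (real_pt R z) <= X ->
  C * (X ^+ 2 * L ^+ 3) < 1 -> phi x = 0 ->
  rcoord R z 0 * rcoord R x 1 = rcoord R z 1 * rcoord R x 0 /\
  rcoord R z 0 * rcoord R x 2 = rcoord R z 2 * rcoord R x 0.
Proof.
pose C0 : R := 2 + `|xi| + `|xi| ^+ 3.
pose C1 : R := C0 * (2 * `|xi| + 1) + `|xi| ^+ 2 + 1.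
have xi0 := normr_ge0 xi.
have C01 : 1 <= C0.
  rewrite /C0; have : 0 <= `|xi| ^+ 3 by rewrite exprn_ge0.
  lra.
have C0C1 : C0 + 1 <= C1.
  have : 0 <= `|xi| ^+ 2 by rewrite exprn_ge0.
  have : C0 <= C0 * (2 * `|xi| + 1) by rewrite ler_peMr //; lra.
  by rewrite /C1; lra.
have C1p : 0 < C1 by lra.
exists (C1 ^+ 3) => [|x z x_neq0 X L xL L1 zX small phi0]; first by rewrite exprn_gt0.
have xL1 : Lxi xi (real_pt R x) < 1 by apply: le_lt_trans xL L1.
have x00 : x 0 0 != 0 by have := rcoord0_neq0 x_neq0 xL1; rewrite intr_eq0.
have [|e [q [p [xE0 xE1 xE2]]]] := @cuspidal_cubic_param (x 0 0) (x 0 1) (x 0 2) x00.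
  by apply/eqP; rewrite -subr_eq0; exact/eqP.
have [q0 e0] : q != 0 /\ e != 0.
  by split; apply: contraNneq x00; rewrite xE0 => ->; rewrite ?mul0r // expr0n mulr0.
have q1 := norm_int_ge1 R q0; have e1 := norm_int_ge1 R e0.
set Q : R := q%:~R in q1; set P : R := p%:~R; set Er : R := e%:~R in e1.
have c0E : rcoord R x 0 = Er * Q ^+ 3 by rewrite /rcoord xE0 intrM intrXn.
have c1E : rcoord R x 1 = Er * P * Q ^+ 2 by rewrite /rcoord xE1 2!intrM intrXn.
have L0 : 0 <= L := Lxi_ge0 _ _.
have X0 : X <= C0 * (`|Er| * `|Q| ^+ 3).
  by have := supnorm_le_rcoord0 x_neq0 xL1; rewrite c0E normrM normrX.
have QX : `|Q| ^+ 3 <= X.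
  apply: le_trans (rcoord_le_supnorm R x 0); rewrite c0E normrM normrX.
  by rewrite ler_peMl // exprn_ge0.
have xl1 : `|Er| * `|Q| ^+ 2 * `|P - Q * xi| <= L.
  move: xL; rewrite Lxi_le => /andP[+ _]; rewrite c0E c1E.
  have -> : Er * P * Q ^+ 2 - Er * Q ^+ 3 * xi = Er * Q ^+ 2 * (P - Q * xi) by ring.
  by rewrite 2!normrM normrX.
have [z1L z2L] : `|rcoord R z 1 - rcoord R z 0 * xi| <= L /\ `|rcoord R z 2 - rcoord R z 0 * xi ^+ 3| <= L.
  by apply/andP; rewrite -Lxi_le.
have z0X : `|rcoord R z 0| <= X := le_trans (rcoord_le_supnorm R z 0) zX.
have z1X : `|rcoord R z 1| <= X := le_trans (rcoord_le_supnorm R z 1) zX.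
have pq0 := normr_ge0 (P - Q * xi).
have Xpq : X * `|P - Q * xi| <= C0 * (`|Q| * L).
  apply: le_trans (_ : C0 * (`|Er| * `|Q| ^+ 3) * `|P - Q * xi| <= _).
    by rewrite ler_wpM2r.
  have -> : C0 * (`|Er| * `|Q| ^+ 3) * `|P - Q * xi| =
    C0 * (`|Q| * (`|Er| * `|Q| ^+ 2 * `|P - Q * xi|)) by ring.
  by rewrite ler_wpM2l ?ler_wpM2l //; lra.
have QL0 : 0 <= `|Q| * L by rewrite mulr_ge0.
have Q2L : `|Q| * L <= `|Q| ^+ 2 * L.
  by rewrite ler_wpM2r // expr2 ler_peMr.
(* Vanishing of both integers means that z is proportional to (q^3, p q^2, p^3). *)
have n0 : z 0 0 * p - z 0 1 * q = 0.
  apply: (norm_int_lt1 (R := R)); rewrite rmorphB !rmorphM /=.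
  apply: (@norm_lt1_cube _ (C1 * (`|Q| ^+ 2 * L))).
  - by rewrite !mulr_ge0 // ?exprn_ge0 // ltW.
  - have -> : (z 0 0)%:~R * p%:~R - (z 0 1)%:~R * q%:~R =
      rcoord R z 0 * (P - Q * xi) - Q * (rcoord R z 1 - rcoord R z 0 * xi) by rewrite /rcoord; ring.
    apply: le_trans (ler_normB _ _) _; rewrite !normrM.
    have h1 : `|rcoord R z 0| * `|P - Q * xi| <= C0 * (`|Q| * L).
      by apply: le_trans Xpq; rewrite ler_wpM2r.
    have h2 : `|Q| * `|rcoord R z 1 - rcoord R z 0 * xi| <= `|Q| * L by rewrite ler_wpM2l.
    apply: le_trans (lerD h1 h2) _.
    apply: le_trans (_ : C1 * (`|Q| * L) <= _); last by rewrite ler_wpM2l // ltW.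
    have -> : C0 * (`|Q| * L) + `|Q| * L = (C0 + 1) * (`|Q| * L) by ring.
    by rewrite ler_wpM2r.
  - apply: le_lt_trans small; rewrite 2!exprMn ler_wpM2l ?exprn_ge0 ?(ltW C1p) //.
    rewrite ler_wpM2r ?exprn_ge0 // -exprM mulnC exprM lerXn2r // nnegrE ?exprn_ge0 //.
    exact: le_trans (normr_ge0 _) z0X.
have n1 : z 0 1 * p ^+ 2 - z 0 2 * q ^+ 2 = 0.
  apply: (norm_int_lt1 (R := R)); rewrite rmorphB /= 2!intrM !intrXn.
  apply: (@norm_lt1_cube _ (C1 * (`|Q| ^+ 2 * L))).
  - by rewrite !mulr_ge0 // ?exprn_ge0 // ltW.
  - rewrite -/P -/Q -!/(rcoord R _ _).
    have -> : rcoord R z 1 * P ^+ 2 - rcoord R z 2 * Q ^+ 2 =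
      rcoord R z 1 * (P - Q * xi) * (P + Q * xi)
      + Q ^+ 2 * (xi ^+ 2 * (rcoord R z 1 - rcoord R z 0 * xi) - (rcoord R z 2 - rcoord R z 0 * xi ^+ 3)).
      by ring.
    have pq1 : `|P - Q * xi| <= `|Q|.
      apply: le_trans (q1); apply: le_trans (ltW L1); apply: le_trans xl1.
      by apply: ler_peMl => //; apply: mulr_ege1 => //; exact: exprn_ege1.
    have pq2 : `|P + Q * xi| <= `|Q| * (2 * `|xi| + 1).
      have -> : P + Q * xi = (P - Q * xi) + Q * xi * 2 by ring.
      apply: le_trans (ler_normD _ _) _; rewrite !normrM [`|2|]ger0_norm //.
      by apply: le_trans (lerD pq1 (lexx _)) _; lra.
    have h1 : `|rcoord R z 1 * (P - Q * xi) * (P + Q * xi)| <= C0 * (`|Q| * L) * (`|Q| * (2 * `|xi| + 1)).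
      rewrite normrM ler_pM // ?normr_ge0 // normrM.
      by apply: le_trans Xpq; rewrite ler_wpM2r.
    have h2 : `|Q ^+ 2 * (xi ^+ 2 * (rcoord R z 1 - rcoord R z 0 * xi) - (rcoord R z 2 - rcoord R z 0 * xi ^+ 3))|
       <= `|Q| ^+ 2 * (`|xi| ^+ 2 * L + L).
      rewrite normrM normrX ler_wpM2l ?exprn_ge0 //.
      apply: le_trans (ler_normB _ _) _; rewrite lerD // normrM normrX ler_wpM2l //.
      by rewrite exprn_ge0.
    apply: le_trans (ler_normD _ _) _; apply: le_trans (lerD h1 h2) _.
    by rewrite /C1 le_eqVlt; apply/orP; left; apply/eqP; ring.
  - apply: le_lt_trans small; rewrite 2!exprMn ler_wpM2l ?exprn_ge0 ?(ltW C1p) //.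
    rewrite ler_wpM2r ?exprn_ge0 // -exprM mulnC exprM lerXn2r // nnegrE ?exprn_ge0 //.
    exact: le_trans (normr_ge0 _) z0X.
have n0' : z 0 0 * p = z 0 1 * q by apply/eqP; rewrite -subr_eq0 n0.
have n1' : z 0 1 * p ^+ 2 = z 0 2 * q ^+ 2 by apply/eqP; rewrite -subr_eq0 n1.
split; rewrite /rcoord -!intrM; congr (_%:~R); rewrite xE0 ?xE1 ?xE2.
  by transitivity (z 0 0 * p * (e * q ^+ 2)); [ring|rewrite n0'; ring].
transitivity (z 0 0 * p * (e * p ^+ 2)); first ring.
by rewrite n0'; transitivity (z 0 1 * p ^+ 2 * (e * q)); [ring|rewrite n1'; ring].
Qed.
End PhiNonzero.

(** * Binary cubic forms close to a form with a double root *)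

Section Bounds.
Variable R : realFieldType.
Implicit Types x y a b : R.
Lemma le_normD x y a b : `|x| <= a -> `|y| <= b -> `|x + y| <= a + b.
Proof. by move=> h1 h2; apply: le_trans (ler_normD _ _) (lerD h1 h2). Qed.
Lemma le_normN x a : `|x| <= a -> `|- x| <= a.
Proof. by rewrite normrN. Qed.
Lemma le_normM x y a b : `|x| <= a -> `|y| <= b -> `|x * y| <= a * b.
Proof. by move=> h1 h2; rewrite normrM ler_pM. Qed.
Lemma le_normX n x a : `|x| <= a -> `|x ^+ n| <= a ^+ n.
Proof.
move=> h; rewrite normrX lerXn2r ?nnegrE //; exact: le_trans (normr_ge0 _) h.
Qed.
Lemma le_norm_nat n : `|n%:R : R| <= n%:R.
Proof. by rewrite ger0_norm. Qed.
End Bounds.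

(** Bounds the absolute value of an expression by the triangle inequality, from
    bounds for its atoms which are found among the hypotheses. *)
Ltac norm_bound := first
  [ eassumption
  | lazymatch goal with
    | |- is_true (`| - _ | <= _) => eapply le_normN; norm_bound
    | |- is_true (`| _ + _ | <= _) => eapply le_normD; norm_bound
    | |- is_true (`| _ * _ | <= _) => eapply le_normM; norm_bound
    | |- is_true (`| _ ^+ _ | <= _) => eapply le_normX; norm_bound
    | |- _ => apply: le_norm_nat
    end ].

Definition cubic_disc (R : pzRingType) (S T U V : R) : R :=
  T ^+ 2 * U ^+ 2 - 4 * S * U ^+ 3 - 4 * T ^+ 3 * V + 18 * S * T * U * V
  - 27 * S ^+ 2 * V ^+ 2.

(** First coefficient of the Hessian covariant of S s^3 + T s^2 t + U s t^2 + V t^3. *)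
Definition hessian (R : pzRingType) (S T U : R) : R := T ^+ 2 - 3 * S * U.

(** The unperturbed coefficients are those of (s + t)^2 (d s + v t), whose Hessian
    is (d - v)^2 (s + t)^2.  Three times the discriminant of a cubic is minus the
    discriminant of its Hessian, so it is enough to bound the variation of the
    three coefficients of the Hessian. *)
Lemma cubic_disc_perturb (R : realFieldType) (d v e0 e1 e2 e3 K E : R) :
  0 < K -> E <= K -> `|d| <= K -> `|v| <= K ->
  `|e0| <= E -> `|e1| <= E -> `|e2| <= E -> `|e3| <= E ->
  `|cubic_disc (d + e0) (2 * d + v + e1) (d + 2 * v + e2) (v + e3)| <= 2500 * E * K ^+ 3.
Proof.
move=> K0 EK hd hv h0 h1 h2 h3.
have E0 : 0 <= E := le_trans (normr_ge0 _) h0.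
have EE : E * E <= E * K by rewrite ler_wpM2l.
have EK0 : 0 <= E * K by rewrite mulr_ge0 // ltW.
pose S := d + e0; pose T := 2 * d + v + e1; pose U := d + 2 * v + e2; pose V := v + e3.
pose q := (d - v) ^+ 2.
have hq : `|q| <= 4 * K ^+ 2.
  have -> : 4 * K ^+ 2 = (K + K) ^+ 2 by ring.
  by rewrite /q; norm_bound.
have h : `|T ^+ 2 - 3 * S * U - q| <= 34 * (E * K).
  have -> : T ^+ 2 - 3 * S * U - q =
    2 * (2 * d + v) * e1 + e1 * e1 - 3 * (d * e2 + (d + 2 * v) * e0 + e0 * e2).
    by rewrite /T /S /U /q; ring.
  by eapply le_trans; [norm_bound|lra].
have h' : `|T * U - 9 * S * V - 2 * q| <= 34 * (E * K).
  have -> : T * U - 9 * S * V - 2 * q =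
    (2 * d + v) * e2 + (d + 2 * v) * e1 + e1 * e2 - 9 * (d * e3 + v * e0 + e0 * e3).
    by rewrite /T /S /U /V /q; ring.
  by eapply le_trans; [norm_bound|lra].
have h'' : `|U ^+ 2 - 3 * T * V - q| <= 34 * (E * K).
  have -> : U ^+ 2 - 3 * T * V - q =
    2 * (d + 2 * v) * e2 + e2 * e2 - 3 * ((2 * d + v) * e3 + v * e1 + e1 * e3).
    by rewrite /T /V /U /q; ring.
  by eapply le_trans; [norm_bound|lra].
rewrite -(ler_pM2l (_ : 0 < 3)) //.
rewrite -[X in X * `|_|](ger0_norm (_ : 0 <= 3)) // -normrM.
(* This is 4 A C - B^2 for the Hessian (A, B, C), expanded around (q, 2 q, q). *)
have -> : 3 * cubic_disc S T U V =
   4 * q * ((T ^+ 2 - 3 * S * U - q) + (U ^+ 2 - 3 * T * V - q))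
   + 4 * (T ^+ 2 - 3 * S * U - q) * (U ^+ 2 - 3 * T * V - q)
   - 4 * q * (T * U - 9 * S * V - 2 * q)
   - (T * U - 9 * S * V - 2 * q) * (T * U - 9 * S * V - 2 * q).
  by rewrite /cubic_disc; ring.
eapply le_trans; first by norm_bound.
have : (E * K) * (E * K) <= E * K ^+ 3.
  have -> : E * K * (E * K) = E * E * K ^+ 2 by ring.
  have -> : E * K ^+ 3 = E * K * K ^+ 2 by ring.
  by rewrite ler_wpM2r // sqr_ge0.
have -> : 4 * (4 * K ^+ 2) * (34 * (E * K) + 34 * (E * K)) +
  4 * (34 * (E * K)) * (34 * (E * K)) + 4 * (4 * K ^+ 2) * (34 * (E * K)) +
  34 * (E * K) * (34 * (E * K)) = 1632 * (E * K ^+ 3) + 5780 * ((E * K) * (E * K)) by ring.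
have : 0 <= E * K ^+ 3 by rewrite mulr_ge0 // exprn_ge0 // ltW.
lra.
Qed.

(** If T is small then v is close to - 2 d, so that S^2 V is close to d^2 v, which
    has size comparable to K^3; if T is not small the hypothesis on T^6 applies. *)
Lemma cubic_S2V_lower (R : realFieldType) (d v e0 e1 e3 K k : R) :
  0 < K -> 0 < k -> `|d| <= K -> `|v| <= K -> K = `|d| \/ K = `|v| ->
  `|e0| <= K / 100 -> `|e1| <= K / 100 -> `|e3| <= K / 100 ->
  let S := d + e0 in let T := 2 * d + v + e1 in let V := v + e3 in
  k * T ^+ 6 <= (S ^+ 2 * V) ^+ 2 ->
  Num.min (k / 10 ^+ 6) (1 / 200) * K ^+ 6 <= (S ^+ 2 * V) ^+ 2.
Proof.
move=> K0 k0 hd hv hK h0 h1 h3 S T V hT.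
have K6 : 0 <= K ^+ 6 by rewrite exprn_ge0 // ltW.
have [big|small] := leP (K / 10) `|T|.
  apply: le_trans hT; apply: le_trans (_ : k / 10 ^+ 6 * K ^+ 6 <= _).
    by rewrite ler_wpM2r // ge_min lexx.
  rewrite -mulrA ler_wpM2l ?(ltW k0) //.
  have -> : T ^+ 6 = `|T| ^+ 6 by rewrite (exprM _ 2 3) (exprM `|T| 2 3) real_normK ?num_real.
  have -> : (10 ^+ 6)^-1 * K ^+ 6 = (K / 10) ^+ 6 by rewrite exprMn exprVn mulrC.
  by rewrite lerXn2r ?nnegrE ?normr_ge0 // divr_ge0 // ltW.
apply: le_trans (_ : (1 / 200) * K ^+ 6 <= _).
  by rewrite ler_wpM2r // ge_min lexx orbT.
have [Sl Vl] : 2 / 5 * K <= `|S| /\ 9 / 10 * K <= `|V|.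
  move: small h0 h1 h3 hd hv hK; rewrite /S /T /V.
  rewrite ltr_norml !ler_norml
    => /andP[s1 s2] /andP[a1 a2] /andP[b1 b2] /andP[c1 c2] /andP[d1 d2] /andP[v1 v2].
  rewrite !ler_normr => hK {hT K6 k0}.
  by case: hK; case: (ger0P d) => d0; case: (ger0P v) => v0 hK; split; apply/orP;
    (left; lra) || (right; lra).
have -> : (S ^+ 2 * V) ^+ 2 = (`|S| ^+ 2 * `|V|) ^+ 2.
  by rewrite -normrX -normrM real_normK ?num_real.
have -> : 1 / 200 * K ^+ 6 = 1/ 200 * (K ^+ 3) ^+ 2 by rewrite -exprM.
have K3 : 0 <= K ^+ 3 by rewrite exprn_ge0 // ltW.
have SV : (2 / 5 * K) ^+ 2 * (9 / 10 * K) <= `|S| ^+ 2 * `|V|.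
  apply: ler_pM => //; rewrite ?sqr_ge0 //; first lra.
  by apply: lerXn2r; rewrite ?nnegrE //; lra.
apply: le_trans (_ : ((2 / 5 * K) ^+ 2 * (9 / 10 * K)) ^+ 2 <= _).
  have -> : ((2 / 5 * K) ^+ 2 * (9 / 10 * K)) ^+ 2 = (36 / 250) ^+ 2 * (K ^+ 3) ^+ 2 by field.
  by rewrite ler_wpM2r ?sqr_ge0 //; lra.
rewrite lerXn2r ?nnegrE //.
  by rewrite mulr_ge0 ?sqr_ge0 //; lra.
by rewrite mulr_ge0 ?sqr_ge0.
Qed.

(** The alternative D = 0 holds because |S^2 D| is at most a small constant times
    K^6, whereas (S^2 V)^2 is at least a fixed constant times K^6; the bound
    for H is obtained from K^6 >= S^6 / 64. *)
Lemma near_double_root (R : realFieldType) (k : R) : 0 < k ->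
  exists eta c : R, [/\ 0 < eta, 0 < c & forall d v e0 e1 e2 e3 K : R,
    0 < K -> `|d| <= K -> `|v| <= K -> K = `|d| \/ K = `|v| ->
    `|e0| <= eta * K -> `|e1| <= eta * K -> `|e2| <= eta * K -> `|e3| <= eta * K ->
    let S := d + e0 in let T := 2 * d + v + e1 in
    let U := d + 2 * v + e2 in let V := v + e3 in
    let D := cubic_disc S T U V in let H := hessian S T U in
    S != 0 -> k * T ^+ 6 <= (S ^+ 2 * V) ^+ 2 ->
    S ^+ 2 * D = 0 \/ k * (S ^+ 2 * V) ^+ 2 <= `|S ^+ 2 * D| ->
    H ^+ 3 = 0 \/ k * (S ^+ 2 * V) ^+ 2 <= `|H ^+ 3| ->
    D = 0 /\ (H = 0 \/ c * S ^+ 2 <= `|H|)].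
Proof.
move=> k0; pose c1 := Num.min (k / 10 ^+ 6) (1 / 200).
have c10 : 0 < c1 by rewrite lt_min !divr_gt0 // exprn_gt0.
pose eta := Num.min (1 / 100) (k * c1 / 20000).
have eta0 : 0 < eta by rewrite lt_min !divr_gt0 ?mulr_gt0.
pose c := Num.min 1 (k * c1 / 64).
have c0 : 0 < c by rewrite lt_min ltr01 divr_gt0 ?mulr_gt0.
exists eta, c; split => // d v e0 e1 e2 e3 K K0 hd hv hK h0 h1 h2 h3 S T U V D H S0 hT hD hH.
have K6 : 0 < K ^+ 6 by rewrite exprn_gt0.
have eta1 : eta <= 1 / 100 by rewrite ge_min lexx.
have eta2 : eta <= k * c1 / 20000 by rewrite ge_min lexx orbT.
have etaK : eta * K <= K / 100.
  by rewrite [K / 100]mulrC ler_wpM2r ?(ltW K0) // -div1r.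
have low : c1 * K ^+ 6 <= (S ^+ 2 * V) ^+ 2.
  by apply: cubic_S2V_lower hT => //; exact: le_trans etaK.
have SK : `|S| <= 2 * K.
  apply: le_trans (ler_normD _ _) _; apply: le_trans (lerD hd (le_trans h0 etaK)) _.
  by move: (K0); clear=> ?; lra.
have S2 : S ^+ 2 <= 4 * K ^+ 2.
  have -> : 4 * K ^+ 2 = (2 * K) ^+ 2 by ring.
  rewrite -[X in X <= _]real_normK ?num_real //.
  by apply: lerXn2r => //; rewrite nnegrE // mulr_ge0 // ltW.
have D0 : D = 0.
  have [/eqP|ge] := hD.
    by rewrite mulf_eq0 expf_eq0 /= (negPf S0) => /eqP.
  have hDK : `|D| <= 2500 * (eta * K) * K ^+ 3.
    apply: cubic_disc_perturb => //; apply: le_trans etaK _.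
    by move: (K0); clear=> ?; lra.
  have ub : `|S ^+ 2 * D| <= 10000 * eta * K ^+ 6.
    rewrite normrM normrX real_normK ?num_real //.
    have -> : 10000 * eta * K ^+ 6 = 4 * K ^+ 2 * (2500 * (eta * K) * K ^+ 3) by ring.
    by rewrite ler_pM ?sqr_ge0.
  have l1 : k * (c1 * K ^+ 6) <= 10000 * eta * K ^+ 6.
    by apply: le_trans ub; apply: le_trans ge; rewrite ler_wpM2l // ltW.
  have l2 : 10000 * eta * K ^+ 6 <= k * c1 / 2 * K ^+ 6.
    apply: ler_wpM2r; first exact: ltW.
    by move: eta2; clear; move: eta (k * c1) => ? ? ?; lra.
  have l3 : 0 < k * (c1 * K ^+ 6) by rewrite !mulr_gt0.
  have := le_trans l1 l2; have -> : k * c1 / 2 * K ^+ 6 = k * (c1 * K ^+ 6) / 2 by field.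
  by move: l3; clear; move: (k * _) => ? ? ?; lra.
split => //.
have [/eqP|ge] := hH; first by rewrite expf_eq0 /= => /eqP; left.
have cS : 0 <= c * S ^+ 2 by apply: mulr_ge0; [exact: ltW|exact: sqr_ge0].
right; rewrite -(@ler_pXn2r _ 3) ?nnegrE //.
rewrite -normrX; apply: le_trans ge.
have c3 : c ^+ 3 <= k * c1 / 64.
  apply: le_trans (_ : c <= _); last by rewrite ge_min lexx orbT.
  have c_le1 : c <= 1 by rewrite ge_min lexx.
  by rewrite exprS ler_piMr ?(ltW c0) // exprn_ile1 // ltW.
apply: le_trans (_ : k * (c1 * K ^+ 6) <= _); last by rewrite ler_wpM2l // ltW.
have -> : (c * S ^+ 2) ^+ 3 = c ^+ 3 * (S ^+ 2) ^+ 3 by rewrite exprMn.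
apply: le_trans (_ : k * c1 / 64 * (4 * K ^+ 2) ^+ 3 <= _).
  have c3p : 0 <= c ^+ 3 by rewrite exprn_ge0 // ltW.
  have S6 : (S ^+ 2) ^+ 3 <= (4 * K ^+ 2) ^+ 3.
    by rewrite lerXn2r ?nnegrE ?sqr_ge0 // mulr_ge0 ?sqr_ge0.
  by apply: ler_pM => //; rewrite exprn_ge0 ?sqr_ge0.
by rewrite le_eqVlt; apply/orP; left; apply/eqP; field.
Qed.

(** * Lines in special position with respect to the cuspidal cubic *)

(** Coordinates of the cross product of x and y, a normal vector of the plane
    that they span. *)
Definition wedge0 (K : pzRingType) (x y : 'rV[K]_3) : K := x 0 1 * y 0 2 - x 0 2 * y 0 1.
Definition wedge1 (K : pzRingType) (x y : 'rV[K]_3) : K := x 0 2 * y 0 0 - x 0 0 * y 0 2.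
Definition wedge2 (K : pzRingType) (x y : 'rV[K]_3) : K := x 0 0 * y 0 1 - x 0 1 * y 0 0.

(** The line with equation a x_0 + b x_1 + c x_2 = 0 meets the curve (1, t, t^3) where
    c t^3 + b t + a = 0, a polynomial of discriminant - c (4 b^3 + 27 a^2 c); the
    remaining factor c^2 accounts for the cusp (0, 0, 1). *)
Lemma cubic_disc_wedge (K : comNzRingType) (x y : 'rV[K]_3) :
  cubic_disc (formS x y) (formT x y) (formU x y) (formV x y) =
  - (wedge2 x y ^+ 3 * (4 * wedge1 x y ^+ 3 + 27 * wedge0 x y ^+ 2 * wedge2 x y)).
Proof.
rewrite /cubic_disc /formS /formT /formU /formV /phi /Phi /wedge0 /wedge1 /wedge2.
move: (x 0 0) (x 0 1) (x 0 2) (y 0 0) (y 0 1) (y 0 2) => x0 x1 x2 y0 y1 y2; ring.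
Qed.

(** The hypothesis says that x lies on the tangent at (1, r, r^3): phi restricted
    to this line has a double zero there, and a simple one at
    (1, - 2 r, - 8 r^3). *)
Lemma tangent_phi (K : comNzRingType) (r : K) (x : 'rV[K]_3) :
  x 0 2 = 3 * r ^+ 2 * x 0 1 - 2 * r ^+ 3 * x 0 0 ->
  phi x = - ((x 0 1 - r * x 0 0) ^+ 2 * (2 * r * x 0 0 + x 0 1)).
Proof.
rewrite /phi => ->; move: (x 0 0) (x 0 1) => x0 x1; ring.
Qed.

Lemma tangent_hessian (K : comNzRingType) (r : K) (x y : 'rV[K]_3) :
  x 0 2 = 3 * r ^+ 2 * x 0 1 - 2 * r ^+ 3 * x 0 0 ->
  y 0 2 = 3 * r ^+ 2 * y 0 1 - 2 * r ^+ 3 * y 0 0 ->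
  hessian (formS x y) (formT x y) (formU x y) =
  (3 * r * (x 0 1 - r * x 0 0) * wedge2 x y) ^+ 2.
Proof.
rewrite /hessian /formS /formT /formU /phi /Phi /wedge2 => -> ->.
move: (x 0 0) (x 0 1) (y 0 0) (y 0 1) => x0 x1 y0 y1; ring.
Qed.

Definition int_point (a b c : int) : 'rV[int]_3 := \row_(k < 3) nth 0 [:: a; b; c] k.

Section Constructions.
Variables (R : realType) (xi : R).

Lemma exists_point (a b c : int) (B X : R) : a != 0 ->
  `|b%:~R - a%:~R * xi| < B -> `|c%:~R - a%:~R * xi ^+ 3| < B ->
  `|a%:~R : R| < X -> `|b%:~R : R| < X -> `|c%:~R : R| < X ->
  exists2 z : 'rV[int]_3, z != 0 &
    Lxi xi (real_pt R z) < B /\ supnorm (real_pt R z) < X.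
Proof.
move=> a0 h1 h2 ha hb hc; exists (int_point a b c).
  by apply: contraNneq a0 => /rowP/(_ 0); rewrite !mxE /= => ->.
by rewrite Lxi_lt supnorm_lt /rcoord !mxE /= h1 h2 ha hb hc.
Qed.

(** The line a x_0 + b x_1 = 0 through the cusp meets the curve again at
    (b^3, - a b^2, - a^3); this point is near (1, xi, xi^3) as a + b xi is small. *)
Lemma cusp_line_point (a b : int) (W N B X : R) : b != 0 ->
  `|a%:~R : R| <= W -> `|b%:~R : R| <= W -> `|a%:~R + b%:~R * xi| <= N ->
  W ^+ 3 < X -> W ^+ 2 * (1 + `|xi| + `|xi| ^+ 2) * N < B ->
  exists2 z : 'rV[int]_3, z != 0 &
    Lxi xi (real_pt R z) < B /\ supnorm (real_pt R z) < X.
Proof.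
move=> b0 ha hb hN hX hB.
have N0 : 0 <= N := le_trans (normr_ge0 _) hN.
have W0 : 0 <= W := le_trans (normr_ge0 _) ha.
have x0 := normr_ge0 xi; have x2 : 0 <= `|xi| ^+ 2 by rewrite exprn_ge0.
have lexi : `|xi| <= `|xi| by [].
have W2 : 0 <= W ^+ 2 by rewrite sqr_ge0.
have int3 (u v w : int) : `|u%:~R : R| <= W -> `|v%:~R : R| <= W -> `|w%:~R : R| <= W ->
    `|(u * v * w)%:~R : R| < X.
  move=> hu hv hw; apply: le_lt_trans hX; rewrite !intrM.
  by eapply le_trans; [norm_bound|rewrite -expr2 -exprSr].
have WN1 : W ^+ 2 * N < B.
  apply: le_lt_trans hB; rewrite ler_wpM2r // ler_peMr //; lra.
have ha' : `|(- a)%:~R : R| <= W by rewrite intrN normrN.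
apply: (@exists_point (b * b * b) (- a * b * b) (- a * a * a)).
- by rewrite !mulf_neq0.
- apply: le_lt_trans WN1.
  have -> : (- a * b * b)%:~R - (b * b * b)%:~R * xi =
     - (b%:~R ^+ 2 * (a%:~R + b%:~R * xi)) by rewrite !intrM intrN; ring.
  by norm_bound.
- apply: le_lt_trans hB.
  have -> : (- a * a * a)%:~R - (b * b * b)%:~R * xi ^+ 3 =
     - ((a%:~R ^+ 2 - a%:~R * b%:~R * xi + b%:~R ^+ 2 * xi ^+ 2) * (a%:~R + b%:~R * xi)).
     by rewrite !intrM intrN; ring.
  eapply le_trans; first by norm_bound.
  by rewrite ler_wpM2r // le_eqVlt; apply/orP; left; apply/eqP; ring.
- exact: int3.
- exact: int3.
- exact: int3.
Qed.

(** The tangent at (1, r, r^3) meets the curve again at (1, - 2 r, - 8 r^3), that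
    is at (bc, 3ac, - 4ab).  It is near (1, xi, xi^3) because
    a + b xi + c xi^3 = c (xi - r)^2 (xi + 2 r) is small while xi - r is not. *)
Lemma tangent_line_point (a b c : int) (r W N B X : R) : b != 0 -> c != 0 ->
  (a%:~R : R) = 2 * r ^+ 3 * c%:~R -> (b%:~R : R) = - (3 * r ^+ 2 * c%:~R) ->
  `|xi| <= 4 * `|xi - r| ->
  xi != 0 ->
  `|a%:~R : R| <= W -> `|b%:~R : R| <= W -> `|c%:~R : R| <= W ->
  `|a%:~R + b%:~R * xi + c%:~R * xi ^+ 3| <= N ->
  4 * W ^+ 2 < X -> (16 / `|xi| ^+ 2 + 76) * (W * N) < B ->
  exists2 z : 'rV[int]_3, z != 0 &
    Lxi xi (real_pt R z) < B /\ supnorm (real_pt R z) < X.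
Proof.
move=> b0 c0 aE bE far xi0 ha hb hc hN hX hB.
have N0 : 0 <= N := le_trans (normr_ge0 _) hN.
have W0 : 0 <= W := le_trans (normr_ge0 _) ha.
have WN0 : 0 <= W * N by rewrite mulr_ge0.
have xi2 : 0 < `|xi| ^+ 2 by rewrite exprn_gt0 // normr_gt0.
have WX : W ^+ 2 < X by apply: le_lt_trans hX; rewrite ler_peMl ?sqr_ge0 //; lra.
set g := xi - r in far; have g0 : g != 0.
  by apply: contraNneq xi0 => g0; move: far; rewrite g0 normr0 mulr0 normr_le0.
have g2 : 0 < g ^+ 2 by rewrite exprn_even_gt0.
have far2 : `|xi| ^+ 2 <= 16 * g ^+ 2.
  have -> : 16 * g ^+ 2 = (4 * `|g|) ^+ 2 by rewrite exprMn real_normK ?num_real //; ring.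
  by rewrite lerXn2r ?nnegrE ?mulr_ge0.
have key : `|b%:~R * (a%:~R + b%:~R * xi + c%:~R * xi ^+ 3)| <= W * N by norm_bound.
apply: (@exists_point (b * c) (3 * a * c) (- 4 * a * b)).
- by rewrite mulf_neq0.
- apply: le_lt_trans hB; rewrite [X in _ <= X]mulrDl -[X in X <= _]addr0.
  apply: lerD; last by rewrite mulr_ge0.
  rewrite [X in _ <= X]mulrAC ler_pdivlMr //.
  apply: le_trans (_ : `|(3 * a * c)%:~R - (b * c)%:~R * xi| * (16 * g ^+ 2) <= _).
    by rewrite ler_wpM2l.
  rewrite [X in X <= _]mulrCA ler_wpM2l // -[g ^+ 2]ger0_norm ?sqr_ge0 // -normrM.
  apply: le_trans key; rewrite le_eqVlt; apply/orP; left; apply/eqP; rewrite -[RHS]normrN.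
  by congr `|_|; rewrite !intrM aE bE /g; ring.
- apply: le_lt_trans hB; rewrite [X in _ <= X]mulrDl -[X in X <= _]add0r; apply: lerD.
    by rewrite mulr_ge0 // divr_ge0 // ltW.
  rewrite -(ler_pM2r g2)
    -[X in X <= _](_ : `|((-4 * a * b)%:~R - (b * c)%:~R * xi ^+ 3) * g ^+ 2| = _); last first.
    by rewrite normrM [`|g ^+ 2|]ger0_norm ?sqr_ge0.
  have -> : ((-4 * a * b)%:~R - (b * c)%:~R * xi ^+ 3) * g ^+ 2 =
    - (b%:~R * (a%:~R + b%:~R * xi + c%:~R * xi ^+ 3) * (3 * xi ^+ 2 - 6 * xi * g + 4 * g ^+ 2)).
    by rewrite !intrM aE bE /g; ring.
  have q76 : `|3 * xi ^+ 2 - 6 * xi * g + 4 * g ^+ 2| <= 76 * g ^+ 2.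
    have -> : 76 * g ^+ 2 = 3 * (4 * `|g|) ^+ 2 + 6 * (4 * `|g|) * `|g| + 4 * `|g| ^+ 2.
      by rewrite -[g ^+ 2]real_normK ?num_real //; ring.
    have gg : `|g| <= `|g| by [].
    by norm_bound.
  rewrite normrN normrM.
  by eapply le_trans; [exact: ler_pM (normr_ge0 _) (normr_ge0 _) key q76|rewrite mulrCA mulrA].
- by apply: le_lt_trans WX; rewrite intrM expr2; norm_bound.
- apply: le_lt_trans hX; rewrite !intrM; apply: le_trans (_ : 3 * W * W <= _).
    by norm_bound.
  by rewrite -mulrA -expr2 ler_wpM2r ?sqr_ge0 //; lra.
- apply: le_lt_trans hX; rewrite !intrM intrN; apply: le_trans (_ : 4 * W * W <= _).
    by norm_bound.
  by rewrite -mulrA -expr2.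
Qed.

(** All the estimates come from subtracting from x and y their multiples of
    (1, xi, xi^3) with the same first coordinate; in the last one, these
    multiples cancel completely. *)
Lemma wedge_bounds : exists2 C : R, 0 < C & forall x y : 'rV[int]_3,
  let X := supnorm (real_pt R y) in
  let L := Lxi xi (real_pt R x) in let L' := Lxi xi (real_pt R y) in
  supnorm (real_pt R x) <= X -> L' <= L -> L <= X ->
  [/\ `|(wedge0 x y)%:~R : R| <= C * (X * L), `|(wedge1 x y)%:~R : R| <= C * (X * L),
      `|(wedge2 x y)%:~R : R| <= C * (X * L) &
      `|(wedge0 x y)%:~R + (wedge1 x y)%:~R * xi + (wedge2 x y)%:~R * xi ^+ 3| <= 2 * (L * L')].
Proof.
have x0 := normr_ge0 xi.
have x3 : 0 <= `|xi| ^+ 3 by rewrite exprn_ge0.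
have xx : `|xi| <= `|xi| by [].
exists (2 * (1 + `|xi| + `|xi| ^+ 3)) => [|x y X L L' xX LL LX]; first lra.
have L0 : 0 <= L := Lxi_ge0 _ _.
have L'0 : 0 <= L' := Lxi_ge0 _ _.
have X0 : 0 <= X := le_trans L0 LX.
have XL0 : 0 <= X * L by rewrite mulr_ge0.
have [d1 d2] : `|rcoord R x 1 - rcoord R x 0 * xi| <= L /\ `|rcoord R x 2 - rcoord R x 0 * xi ^+ 3| <= L.
  by apply/andP; rewrite -Lxi_le.
have [e1' e2'] : `|rcoord R y 1 - rcoord R y 0 * xi| <= L' /\ `|rcoord R y 2 - rcoord R y 0 * xi ^+ 3| <= L'.
  by apply/andP; rewrite -Lxi_le.
have [e1 e2] := (le_trans e1' LL, le_trans e2' LL).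
have hx0 : `|rcoord R x 0| <= X := le_trans (rcoord_le_supnorm R x 0) xX.
have hy0 : `|rcoord R y 0| <= X := rcoord_le_supnorm R y 0.
set p1 := _ - _ in d1; set p2 := _ - _ in d2; set q1 := _ - _ in e1 e1'; set q2 := _ - _ in e2 e2'.
have le2 : 2 * (X * L) <= 2 * (1 + `|xi| + `|xi| ^+ 3) * (X * L) by rewrite ler_wpM2r //; lra.
have LLX : L * L <= X * L by rewrite ler_wpM2r.
have wE0 : (wedge0 x y)%:~R = rcoord R x 1 * rcoord R y 2 - rcoord R x 2 * rcoord R y 1.
  by rewrite /wedge0 rmorphB /= !intrM.
have wE1 : (wedge1 x y)%:~R = rcoord R x 2 * rcoord R y 0 - rcoord R x 0 * rcoord R y 2.
  by rewrite /wedge1 rmorphB /= !intrM.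
have wE2 : (wedge2 x y)%:~R = rcoord R x 0 * rcoord R y 1 - rcoord R x 1 * rcoord R y 0.
  by rewrite /wedge2 rmorphB /= !intrM.
split.
- have -> : (wedge0 x y)%:~R = rcoord R x 0 * xi * q2 + p1 * (rcoord R y 0 * xi ^+ 3) + p1 * q2
     - (rcoord R x 0 * xi ^+ 3 * q1 + p2 * (rcoord R y 0 * xi) + p2 * q1).
    by rewrite wE0 /p1 /p2 /q1 /q2; ring.
  eapply le_trans; first by clear e1' e2'; norm_bound.
  have -> : X * `|xi| * L + L * (X * `|xi| ^+ 3) + L * L + (X * `|xi| ^+ 3 * L + L * (X * `|xi|) + L * L)
     = 2 * (L * L) + 2 * (`|xi| + `|xi| ^+ 3) * (X * L) by ring.
  have -> : 2 * (1 + `|xi| + `|xi| ^+ 3) * (X * L) = 2 * (X * L) + 2 * (`|xi| + `|xi| ^+ 3) * (X * L) by ring.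
  by rewrite lerD2r ler_wpM2l.
- apply: le_trans le2.
  have -> : (wedge1 x y)%:~R = p2 * rcoord R y 0 - rcoord R x 0 * q2 by rewrite wE1 /p2 /q2; ring.
  by eapply le_trans; [clear e1' e2'; norm_bound|rewrite [L * X]mulrC -mulr2n mulr_natl].
- apply: le_trans le2.
  have -> : (wedge2 x y)%:~R = rcoord R x 0 * q1 - p1 * rcoord R y 0 by rewrite wE2 /p1 /q1; ring.
  by eapply le_trans; [clear e1' e2'; norm_bound|rewrite [L * X]mulrC -mulr2n mulr_natl].
- have -> : (wedge0 x y)%:~R + (wedge1 x y)%:~R * xi + (wedge2 x y)%:~R * xi ^+ 3
    = p1 * q2 - p2 * q1 by rewrite wE0 wE1 wE2 /p1 /p2 /q1 /q2; ring.
  by eapply le_trans; [clear e1 e2; norm_bound|rewrite -mulr2n mulr_natl].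
Qed.
End Constructions.

(** * The restriction of phi to the line through two minimal points *)

Section LocalForms.
Variables (R : realType) (xi : R).

Lemma real_ptE (z : 'rV[int]_3) k : real_pt R z 0 k = rcoord R z k.
Proof. by rewrite /real_pt mxE. Qed.

(** With p = x_1 - x_0 xi and D(x) = x_2 - 3 xi^2 x_1 + 2 xi^3 x_0, the equation of
    the tangent at (1, xi, xi^3), one has
    phi(x) = x_0^2 D(x) - 3 xi x_0 p^2 - p^3.
    Applied to s x + t (x_0 / y_0) y, whose first coordinate is x_0 (s + t), this
    gives the main term (s + t)^2 (d s + v t). *)
Lemma forms_near_double : exists2 C : R, 0 < C & forall x y : 'rV[int]_3,
  let X := supnorm (real_pt R x) in let L := Lxi xi (real_pt R x) in
  let t := rcoord R x 0 / rcoord R y 0 in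
  let x' := real_pt R x in let y' := real_pt R y in
  x != 0 -> y != 0 -> L < 1 -> Lxi xi (real_pt R y) <= L -> X <= supnorm (real_pt R y) ->
  t != 0 /\
  exists d v e0 e1 e2 e3 : R,
    [/\ `|e0| <= C * (X * L ^+ 2), `|e1| <= C * (X * L ^+ 2),
        `|e2| <= C * (X * L ^+ 2) & `|e3| <= C * (X * L ^+ 2)] /\
    [/\ formS x' y' = d + e0, t * formT x' y' = 2 * d + v + e1,
        t ^+ 2 * formU x' y' = d + 2 * v + e2 & t ^+ 3 * formV x' y' = v + e3].
Proof.
pose C0 : R := 2 + `|xi| + `|xi| ^+ 3.
have xi0 := normr_ge0 xi; have xi3 : 0 <= `|xi| ^+ 3 by rewrite exprn_ge0.
have C01 : 1 <= C0 by rewrite /C0; lra.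
have C0p : 0 <= C0 by lra.
have C02 : C0 <= C0 ^+ 2 by rewrite expr2 ler_peMl.
have C03 : C0 ^+ 2 <= C0 ^+ 3 by rewrite [C0 ^+ 3]exprS ler_peMl // sqr_ge0.
have xx : `|xi| <= `|xi| by [].
exists ((9 * `|xi| + 3) * C0 ^+ 3) => [|x y X L t x' y' x0 y0 L1 yL xy].
  by rewrite mulr_gt0 ?exprn_gt0 //; lra.
have hx0 := rcoord0_neq0 x0 L1; have hy0 := rcoord0_neq0 y0 (le_lt_trans yL L1).
have X1 : 1 <= X.
  by apply: le_trans (rcoord_le_supnorm R x 0); apply: norm_int_ge1; rewrite -(intr_eq0 R).
have L0 : 0 <= L := Lxi_ge0 _ _.
have ht : `|t| <= C0.
  rewrite /t normrM normfV ler_pdivrMr ?normr_gt0 //.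
  apply: le_trans (rcoord_le_supnorm R x 0) _; apply: le_trans xy _.
  exact: supnorm_le_rcoord0 y0 (le_lt_trans yL L1).
split; first by rewrite mulf_neq0 // invr_eq0.
have hX : `|rcoord R x 0| <= X := rcoord_le_supnorm R x 0.
have tyE : t * rcoord R y 0 = rcoord R x 0 by rewrite /t divfK.
have [d1 _] : `|rcoord R x 1 - rcoord R x 0 * xi| <= L /\ `|rcoord R x 2 - rcoord R x 0 * xi ^+ 3| <= L.
  by apply/andP; rewrite -Lxi_le.
have [e1' _] : `|rcoord R y 1 - rcoord R y 0 * xi| <= L /\ `|rcoord R y 2 - rcoord R y 0 * xi ^+ 3| <= L.
  by apply/andP; rewrite -Lxi_le.
pose p := rcoord R x 1 - rcoord R x 0 * xi.
pose q := t * (rcoord R y 1 - rcoord R y 0 * xi).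
have hp : `|p| <= L by [].
have hq : `|q| <= C0 * L by rewrite /q; apply: le_normM.
pose Dx := rcoord R x 2 - 3 * xi ^+ 2 * rcoord R x 1 + 2 * xi ^+ 3 * rcoord R x 0.
pose Dy := rcoord R y 2 - 3 * xi ^+ 2 * rcoord R y 1 + 2 * xi ^+ 3 * rcoord R y 0.
exists (rcoord R x 0 ^+ 2 * Dx), (t * rcoord R x 0 ^+ 2 * Dy).
exists (- (3 * xi * (rcoord R x 0 * p ^+ 2)) - p ^+ 3).
exists (- (3 * xi * (rcoord R x 0 * p ^+ 2 + 2 * (rcoord R x 0 * (p * q)))) - 3 * (p ^+ 2 * q)).
exists (- (3 * xi * (rcoord R x 0 * q ^+ 2 + 2 * (rcoord R x 0 * (p * q)))) - 3 * (p * q ^+ 2)).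
exists (- (3 * xi * (rcoord R x 0 * q ^+ 2)) - q ^+ 3).
split; last first.
  rewrite /x' /y' /formS /formT /formU /formV /Phi /phi !real_ptE -tyE /p /q /Dx /Dy.
  rewrite -tyE.
  move: (rcoord R x 1) (rcoord R x 2) (rcoord R y 0) (rcoord R y 1) (rcoord R y 2) => a b u v w.
  by split; ring.
have XL2 : 0 <= X * L ^+ 2 by rewrite mulr_ge0 ?sqr_ge0 //; lra.
have L3 : L ^+ 3 <= X * L ^+ 2.
  by rewrite exprS ler_wpM2r ?sqr_ge0 //; lra.
have xiC n : (n <= 3)%N -> `|xi| * C0 ^+ n <= `|xi| * C0 ^+ 3.
  by move=> le3; rewrite ler_wpM2l // ler_weXn2l.
have Cn n : (n <= 3)%N -> C0 ^+ n <= C0 ^+ 3 by move=> le3; rewrite ler_weXn2l.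
have := (xiC 0 isT, xiC 1 isT, xiC 2 isT); rewrite expr0 expr1 mulr1 => -[[xi_0 xi_1] xi_2].
have := (Cn 0 isT, Cn 1 isT, Cn 2 isT); rewrite expr0 expr1 => -[[c_0 c_1] c_2].
have xi_3 : 0 <= `|xi| * C0 ^+ 3 by rewrite mulr_ge0 // exprn_ge0.
have fin (A B : R) : 0 <= B -> A + B <= (9 * `|xi| + 3) * C0 ^+ 3 ->
    A * (X * L ^+ 2) + B * L ^+ 3 <= (9 * `|xi| + 3) * C0 ^+ 3 * (X * L ^+ 2).
  move=> B0 AB; apply: le_trans (_ : (A + B) * (X * L ^+ 2) <= _).
    by rewrite mulrDl lerD2l ler_wpM2l.
  by rewrite ler_wpM2r.
have fin' A B Z : 0 <= B -> A + B <= (9 * `|xi| + 3) * C0 ^+ 3 ->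
    Z = A * (X * L ^+ 2) + B * L ^+ 3 -> Z <= (9 * `|xi| + 3) * C0 ^+ 3 * (X * L ^+ 2).
  by move=> h1 h2 ->; apply: fin.
have e9 : (9 * `|xi| + 3) * C0 ^+ 3 = 9 * (`|xi| * C0 ^+ 3) + 3 * C0 ^+ 3 by ring.
split; (eapply le_trans; [clear xi_0; norm_bound|]).
- apply: (fin' (3 * `|xi|) 1) => //; last ring.
  by rewrite e9; clear -xi_0 xi_3 c_0; lra.
- apply: (fin' (3 * `|xi| + 6 * (`|xi| * C0)) (3 * C0)); [lra| |ring].
  by rewrite e9; clear -xi_0 xi_3 c_0 xi_1 c_1; lra.
- apply: (fin' (3 * (`|xi| * C0 ^+ 2) + 6 * (`|xi| * C0)) (3 * C0 ^+ 2)); [|  |ring].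
    by rewrite mulr_ge0 // exprn_ge0.
  by rewrite e9; clear -xi_0 xi_3 c_0 xi_1 c_1 xi_2 c_2; lra.
- apply: (fin' (3 * (`|xi| * C0 ^+ 2)) (C0 ^+ 3)); [|  |ring].
    by rewrite exprn_ge0.
  by rewrite e9; clear -xi_0 xi_3 c_0 xi_1 c_1 xi_2 c_2; lra.
Qed.

(** The hypotheses are homogeneous under the rescaling of y by t = x_0 / y_0, which
    brings f close to a form with a double root, so that [near_double_root]
    applies; S <> 0 is an integer, which bounds |d| from below. *)
Lemma degenerate_forms (k : R) : 0 < k -> exists C c : R, [/\ 0 < C, 0 < c &
  forall x y : 'rV[int]_3,
  let X := supnorm (real_pt R x) in let L := Lxi xi (real_pt R x) in
  let t := rcoord R x 0 / rcoord R y 0 in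
  let x' := real_pt R x in let y' := real_pt R y in
  x != 0 -> y != 0 -> L < 1 -> Lxi xi (real_pt R y) <= L -> X <= supnorm (real_pt R y) ->
  C * (X * L ^+ 2) < 1 -> phi x != 0 ->
  let S := formS x' y' in let T := formT x' y' in
  let U := formU x' y' in let V := formV x' y' in
  let D := cubic_disc S T U V in let H := hessian S T U in
  k * T ^+ 6 <= (S ^+ 2 * V) ^+ 2 ->
  S ^+ 2 * D = 0 \/ k * (S ^+ 2 * V) ^+ 2 <= `|S ^+ 2 * D| ->
  H ^+ 3 = 0 \/ k * (S ^+ 2 * V) ^+ 2 <= `|H ^+ 3| ->
  D = 0 /\ (H = 0 \/ c * S ^+ 2 <= t ^+ 2 * `|H|)].
Proof.
move=> k0; have [C C0 hC] := forms_near_double.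
have [eta [c [eta0 c0 hc]]] := near_double_root k0.
exists (2 * C / eta + 2 * C), c; split => //.
  by rewrite addr_gt0 ?divr_gt0 ?mulr_gt0.
move=> x y X L t x' y' x0 y0 L1 yL xy small phi0 S T U V D H hT hD hH.
have [t0 [d [v [e0 [e1 [e2 [e3 [[h0 h1 h2 h3] [hS hT' hU hV]]]]]]]]] := hC x y x0 y0 L1 yL xy.
rewrite -/X -/L in h0 h1 h2 h3; rewrite -/t -/x' -/y' in t0 hS hT' hU hV.
rewrite -/S in hS; rewrite -/T in hT'; rewrite -/U in hU; rewrite -/V in hV.
have SE : S = (phi x)%:~R by rewrite phi_rcoord /S /formS /phi !real_ptE.
have S1 : 1 <= `|S| by rewrite SE norm_int_ge1.
have S0 : S != 0 by rewrite -normr_gt0; apply: lt_le_trans S1.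
have XL0 : 0 <= X * L ^+ 2.
  by rewrite mulr_ge0 ?sqr_ge0 //; apply: le_trans (rcoord_le_supnorm R x 0).
have [s1 s2] : C * (X * L ^+ 2) <= eta / 2 /\ C * (X * L ^+ 2) <= 1 / 2.
  move: small; have -> : (2 * C / eta + 2 * C) * (X * L ^+ 2) =
    2 * (C * (X * L ^+ 2)) / eta + 2 * (C * (X * L ^+ 2)) by field; exact: lt0r_neq0.
  have A0 : 0 <= C * (X * L ^+ 2) by rewrite mulr_ge0 // ltW.
  have B0 : 0 <= 2 * (C * (X * L ^+ 2)) / eta by rewrite divr_ge0 ?(ltW eta0) // mulr_ge0.
  move=> small; split.
    have : 2 * (C * (X * L ^+ 2)) / eta <= 1 by clear -small A0 B0; lra.
    by rewrite ler_pdivrMr // mul1r; clear; move: (C * _) => ? ?; lra.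
  by clear -small A0 B0; lra.
pose K := Num.max `|d| `|v|.
have dK : `|d| <= K by rewrite le_max lexx.
have vK : `|v| <= K by rewrite le_max lexx orbT.
have K2 : 1 / 2 <= K.
  apply: le_trans dK; have := ler_normD d e0; rewrite -hS.
  by move: h0 s2 S1; clear; lra.
have K0 : 0 < K by move: K2; clear; lra.
have hK : K = `|d| \/ K = `|v|.
  by rewrite /K /Num.max; case: ifP; [right|left].
have etaK : C * (X * L ^+ 2) <= eta * K.
  apply: le_trans s1 _; rewrite ler_wpM2l ?(ltW eta0) //.
  by move: K2; clear; lra.
have key := hc d v e0 e1 e2 e3 K K0 dK vK hK (le_trans h0 etaK) (le_trans h1 etaK)
  (le_trans h2 etaK) (le_trans h3 etaK).
move: key; rewrite -hS -hT' -hU -hV /= => key.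
have t6 : 0 < t ^+ 6 by rewrite (exprM t 3 2) exprn_even_gt0 // expf_neq0.
have DE : cubic_disc S (t * T) (t ^+ 2 * U) (t ^+ 3 * V) = t ^+ 6 * D.
  by rewrite /D /cubic_disc; ring.
have HE : hessian S (t * T) (t ^+ 2 * U) = t ^+ 2 * H by rewrite /H /hessian; ring.
have GE : (S ^+ 2 * (t ^+ 3 * V)) ^+ 2 = t ^+ 6 * (S ^+ 2 * V) ^+ 2 by ring.
rewrite DE HE GE in key.
have [] := key S0.
- have -> : k * (t * T) ^+ 6 = t ^+ 6 * (k * T ^+ 6) by ring.
  by rewrite ler_pM2l.
- have -> : S ^+ 2 * (t ^+ 6 * D) = t ^+ 6 * (S ^+ 2 * D) by ring.
  case: hD => [->|hD]; first by left; rewrite mulr0.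
  by right; rewrite normrM gtr0_norm // mulrCA ler_pM2l.
- have -> : (t ^+ 2 * H) ^+ 3 = t ^+ 6 * H ^+ 3 by ring.
  case: hH => [->|hH]; first by left; rewrite mulr0.
  by right; rewrite normrM gtr0_norm // mulrCA ler_pM2l.
move=> /eqP; rewrite mulf_eq0 (gt_eqF t6) /= => /eqP D0 hH'; split=> //.
case: hH' => [/eqP|hH'].
  by rewrite mulf_eq0 expf_eq0 /= (negPf t0) /= => /eqP; left.
by right; rewrite normrM [`|t ^+ 2|]ger0_norm ?sqr_ge0 in hH'.
Qed.

(** Let h = x_1 - r x_0.  Then S = - h^2 (2 r x_0 + x_1), and H = 9 r^2 h^2 times the
    square of wedge2, so that the lower bound for H becomes an upper bound for
    |h| |2 r x_0 + x_1| by a multiple of |r| X L.  If r were close to xi, then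
    2 r x_0 + x_1 would have size X, hence |h| would be bounded by a multiple of L
    and |S| by a multiple of X L^2, which is less than 1. *)
Lemma tangent_far (c : R) : 0 < c -> xi != 0 -> exists2 C : R, 0 < C &
  forall (x y : 'rV[int]_3) (r : R),
  let X := supnorm (real_pt R x) in let L := Lxi xi (real_pt R x) in
  let t := rcoord R x 0 / rcoord R y 0 in
  let x' := real_pt R x in let y' := real_pt R y in
  x != 0 -> y != 0 -> L < 1 -> Lxi xi (real_pt R y) <= L -> X <= supnorm (real_pt R y) ->
  C * (X * L ^+ 2) < 1 -> C * L < 1 -> phi x != 0 ->
  x' 0 2 = 3 * r ^+ 2 * x' 0 1 - 2 * r ^+ 3 * x' 0 0 ->
  y' 0 2 = 3 * r ^+ 2 * y' 0 1 - 2 * r ^+ 3 * y' 0 0 ->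
  c * formS x' y' ^+ 2 <=
    t ^+ 2 * `|hessian (formS x' y') (formT x' y') (formU x' y')| ->
  `|xi| <= 4 * `|xi - r|.
Proof.
move=> c0 xi_neq0.
pose C0 : R := 2 + `|xi| + `|xi| ^+ 3.
have xi0 : 0 < `|xi| by rewrite normr_gt0.
have xi3 : 0 <= `|xi| ^+ 3 by rewrite exprn_ge0 // ltW.
have C01 : 1 <= C0 by rewrite /C0; lra.
have C0p : 0 < C0 by lra.
pose M : R := (3 * (5 / 4) * C0 * (1 + C0)) ^+ 2 / c.
have M0 : 0 < M by rewrite divr_gt0 // exprn_gt0 // !mulr_gt0 //; lra.
pose C : R := M * (5 / 2 * `|xi| + 1) + 1 + `|xi|^-1.
have ixi : 0 < `|xi|^-1 by rewrite invr_gt0.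
have Mx : 0 < M * (5 / 2 * `|xi| + 1) by rewrite mulr_gt0 //; lra.
exists C => [|x y r X L t x' y' x0 y0 L1 yL xy small smallL phi0 xr yr hH]; first by rewrite /C; lra.
rewrite leNgt; apply/negP => near.
have L0 : 0 <= L := Lxi_ge0 _ _.
have hx0 := rcoord0_neq0 x0 L1; have hy0 := rcoord0_neq0 y0 (le_lt_trans yL L1).
have x1 : 1 <= `|rcoord R x 0| by apply: norm_int_ge1; rewrite -(intr_eq0 R).
have X1 : 1 <= X by apply: le_trans (rcoord_le_supnorm R x 0).
have XC : X <= C0 * `|rcoord R x 0| by exact: supnorm_le_rcoord0.
have ht : `|t| <= C0.
  rewrite /t normrM normfV ler_pdivrMr ?normr_gt0 //.
  apply: le_trans (rcoord_le_supnorm R x 0) _; apply: le_trans xy _.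
  exact: supnorm_le_rcoord0 y0 (le_lt_trans yL L1).
have [d1 _] : `|rcoord R x 1 - rcoord R x 0 * xi| <= L /\ `|rcoord R x 2 - rcoord R x 0 * xi ^+ 3| <= L.
  by apply/andP; rewrite -Lxi_le.
have [e1' _] : `|rcoord R y 1 - rcoord R y 0 * xi| <= L /\ `|rcoord R y 2 - rcoord R y 0 * xi ^+ 3| <= L.
  by apply/andP; rewrite -Lxi_le.
have Lxi_small : L <= `|xi|.
  have : `|xi|^-1 * L <= 1.
    apply: le_trans (ltW smallL); rewrite ler_wpM2r // /C; clear -Mx; lra.
  by rewrite mulrC ler_pdivrMr // mul1r.
have rxi : `|r| <= 5 / 4 * `|xi|.
  have -> : r = xi - (xi - r) by ring.
  apply: le_trans (ler_normB _ _) _; move: near; clear; move: `|_ - _| => ?; lra.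
pose h := rcoord R x 1 - r * rcoord R x 0.
pose l := 2 * r * rcoord R x 0 + rcoord R x 1.
have SE : formS x' y' = - (h ^+ 2 * l).
  by rewrite /formS (tangent_phi xr) /h /l /x' !real_ptE.
have S1 : 1 <= `|h ^+ 2 * l|.
  rewrite -normrN -SE /formS.
  have -> : phi x' = (phi x)%:~R by rewrite phi_rcoord /phi !real_ptE.
  exact: norm_int_ge1.
have HE := tangent_hessian xr yr; rewrite HE SE in hH.
have tw : `|t * wedge2 x' y'| <= `|rcoord R x 0| * (C0 * (1 + C0) * L).
  have tyE : t * rcoord R y 0 = rcoord R x 0 by rewrite /t divfK.
  have -> : t * wedge2 x' y' =
      rcoord R x 0 * (t * (rcoord R y 1 - rcoord R y 0 * xi) - (rcoord R x 1 - rcoord R x 0 * xi)).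
    by rewrite /wedge2 /x' /y' !real_ptE -tyE; ring.
  rewrite normrM ler_wpM2l //.
  apply: le_trans (_ : C0 * L + L <= _); first by norm_bound.
  have -> : C0 * L + L = (1 + C0) * L by ring.
  by rewrite ler_wpM2r // ler_peMl //; clear -C0p; lra.
have h0 : h != 0.
  by apply: contraTneq S1 => ->; rewrite expr0n mul0r normr0 ler10.
have ll : `|rcoord R x 0| * `|xi| <= `|l|.
  have := ler_normD l (rcoord R x 0 * (2 * (xi - r)) - (rcoord R x 1 - rcoord R x 0 * xi)).
  have -> : l + (rcoord R x 0 * (2 * (xi - r)) - (rcoord R x 1 - rcoord R x 0 * xi)) = rcoord R x 0 * (3 * xi).
    by rewrite /l; ring.
  have b2 : `|rcoord R x 0 * (2 * (xi - r)) - (rcoord R x 1 - rcoord R x 0 * xi)| <=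
     `|rcoord R x 0| * (2 * `|xi - r|) + L.
    have xx : `|rcoord R x 0| <= `|rcoord R x 0| by [].
    have gg : `|xi - r| <= `|xi - r| by [].
    by apply: le_trans (ler_normB _ _) _; apply: lerD => //; norm_bound.
  have b3 : `|rcoord R x 0| * (2 * `|xi - r|) <= `|rcoord R x 0| * (`|xi| / 2).
    by rewrite ler_wpM2l //; move: near; clear; move: `|_ - _| => ?; lra.
  have b4 : L <= `|rcoord R x 0| * `|xi|.
    by apply: le_trans Lxi_small _; rewrite ler_peMl // ltW.
  rewrite normrM [`|3 * xi|]normrM [`|3|]ger0_norm //.
  move: b2 b3 b4; set z := `|_ - (_ - _)|.
  have a0 := mulr_ge0 (normr_ge0 (rcoord R x 0)) (ltW xi0).
  move: (`|rcoord R x 0|) `|xi - r| a0 => A G a0 b2 b3 b4 b5.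
  have e3 : A * (3 * `|xi|) = 3 * (A * `|xi|) by ring.
  have e2 : A * (`|xi| / 2) = (A * `|xi|) / 2 by ring.
  move: b2 b3 b4 b5; rewrite e3 e2; move: a0.
  move: (z) (L) (A * `|xi|) (A * (2 * G)) `|l|; clear=> *; lra.
(* Divide both sides of the bound for H by c h^2 (x_0 xi)^2. *)
have hL : h ^+ 2 <= M * L ^+ 2.
  have hh : 0 < h ^+ 2 by rewrite exprn_even_gt0.
  have xx2 : 0 < (`|rcoord R x 0| * `|xi|) ^+ 2.
    by rewrite exprn_gt0 // mulr_gt0 ?normr_gt0.
  have step : c * h ^+ 2 * (h ^+ 2 * (`|rcoord R x 0| * `|xi|) ^+ 2) <=
     c * h ^+ 2 * (M * L ^+ 2 * (`|rcoord R x 0| * `|xi|) ^+ 2).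
    apply: le_trans (_ : c * (- (h ^+ 2 * l)) ^+ 2 <= _).
      have -> : c * (- (h ^+ 2 * l)) ^+ 2 = c * h ^+ 2 * (h ^+ 2 * l ^+ 2) by ring.
      apply: ler_wpM2l; first by apply: mulr_ge0; exact: ltW.
      apply: ler_wpM2l; first exact: ltW.
      rewrite -[l ^+ 2]real_normK ?num_real // lerXn2r ?nnegrE //.
      by rewrite mulr_ge0 ?(ltW xi0).
    apply: le_trans hH _; rewrite ger0_norm ?sqr_ge0 //.
    have -> : t ^+ 2 * (3 * r * (x' 0 1 - r * x' 0 0) * wedge2 x' y') ^+ 2 =
      h ^+ 2 * (3 * r * (t * wedge2 x' y')) ^+ 2 by rewrite /h /x' !real_ptE; ring.
    have -> : c * h ^+ 2 * (M * L ^+ 2 * (`|rcoord R x 0| * `|xi|) ^+ 2) =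
      h ^+ 2 * (3 * (5 / 4 * `|xi|) * (`|rcoord R x 0| * (C0 * (1 + C0) * L))) ^+ 2.
      by rewrite /M; field; exact: lt0r_neq0.
    rewrite ler_wpM2l ?(ltW hh) // -[X in X <= _]real_normK ?num_real //.
    have bb : `|3 * r * (t * wedge2 x' y')| <= 3 * (5 / 4 * `|xi|) * (`|rcoord R x 0| * (C0 * (1 + C0) * L)).
      by norm_bound.
    by rewrite lerXn2r ?nnegrE //; apply: le_trans (normr_ge0 _) bb.
  have ch : 0 < c * h ^+ 2 by apply: mulr_gt0.
  by move: step; rewrite (ler_pM2l ch) (ler_pM2r xx2).
have lX : `|l| <= (5 / 2 * `|xi| + 1) * X.
  have a1 := rcoord_le_supnorm R x 1; have a0 := rcoord_le_supnorm R x 0.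
  rewrite /l; eapply le_trans; first by norm_bound.
  by rewrite -/X le_eqVlt; apply/orP; left; apply/eqP; field.
have : `|h ^+ 2 * l| < 1.
  rewrite normrM ger0_norm ?sqr_ge0 //; apply: le_lt_trans small.
  apply: le_trans (_ : M * L ^+ 2 * ((5 / 2 * `|xi| + 1) * X) <= _).
    by apply: ler_pM => //; rewrite sqr_ge0.
  have -> : M * L ^+ 2 * ((5 / 2 * `|xi| + 1) * X) = M * (5 / 2 * `|xi| + 1) * (X * L ^+ 2) by ring.
  rewrite ler_wpM2r ?mulr_ge0 ?sqr_ge0 //; first by clear -X1; lra.
  by rewrite /C; clear -ixi; lra.
by rewrite ltNge S1.
Qed.
End LocalForms.

(** * Coplanar minimal points *)

Definition triple (K : pzRingType) (u v w : 'rV[K]_3) : K :=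
  wedge0 u v * w 0 0 + wedge1 u v * w 0 1 + wedge2 u v * w 0 2.

Lemma free_of_triple (K : fieldType) (u v w : 'rV[K]_3) :
  triple u v w != 0 -> free [:: u; v; w].
Proof.
move=> t0; apply/(@freeP _ _ _ [tuple u; v; w]) => k.
rewrite !big_ord_recl big_ord0 /= addr0.
set k0 := k _; set k1 := k _; set k2 := k _ => E.
have e (m : 'I_3) : k0 * u 0 m + (k1 * v 0 m + k2 * w 0 m) = 0.
  by move/rowP/(_ m): E; rewrite !mxE.
have := (e 0, e 1, e 2) => -[[e0 e1] e2].
have h0 : k0 * triple u v w = 0.
  transitivity (wedge0 v w * (k0 * u 0 0 + (k1 * v 0 0 + k2 * w 0 0))
    + wedge1 v w * (k0 * u 0 1 + (k1 * v 0 1 + k2 * w 0 1))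
    + wedge2 v w * (k0 * u 0 2 + (k1 * v 0 2 + k2 * w 0 2))).
    by rewrite /triple /wedge0 /wedge1 /wedge2; ring.
  by rewrite e0 e1 e2 !mulr0 !addr0.
have h1 : k1 * triple u v w = 0.
  transitivity (wedge0 w u * (k0 * u 0 0 + (k1 * v 0 0 + k2 * w 0 0))
    + wedge1 w u * (k0 * u 0 1 + (k1 * v 0 1 + k2 * w 0 1))
    + wedge2 w u * (k0 * u 0 2 + (k1 * v 0 2 + k2 * w 0 2))).
    by rewrite /triple /wedge0 /wedge1 /wedge2; ring.
  by rewrite e0 e1 e2 !mulr0 !addr0.
have h2 : k2 * triple u v w = 0.
  transitivity (wedge0 u v * (k0 * u 0 0 + (k1 * v 0 0 + k2 * w 0 0))
    + wedge1 u v * (k0 * u 0 1 + (k1 * v 0 1 + k2 * w 0 1))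
    + wedge2 u v * (k0 * u 0 2 + (k1 * v 0 2 + k2 * w 0 2))).
    by rewrite /triple /wedge0 /wedge1 /wedge2; ring.
  by rewrite e0 e1 e2 !mulr0 !addr0.
have z (l : K) : l * triple u v w = 0 -> l = 0.
  by move=> /eqP; rewrite mulf_eq0 (negPf t0) orbF => /eqP.
by move=> m; case: (ord3P m) => ->;
  [rewrite -[RHS](z _ h0)|rewrite -[RHS](z _ h1)|rewrite -[RHS](z _ h2)];
  congr k; apply: val_inj.
Qed.

(** Both cross products are orthogonal to p and q, so they are proportional. *)
Lemma coplanar_trans (K : fieldType) (a b p q z : 'rV[K]_3) :
  wedge1 p q != 0 \/ wedge2 p q != 0 ->
  triple a b p = 0 -> triple a b q = 0 -> triple p q z = 0 -> triple a b z = 0.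
Proof.
rewrite /triple; set u0 := wedge0 a b; set u1 := wedge1 a b; set u2 := wedge2 a b.
move=> w0 hp hq hz.
have c2 : u0 * wedge1 p q = u1 * wedge0 p q.
  apply/eqP; rewrite -subr_eq0; apply/eqP.
  transitivity (p 0 2 * (u0 * q 0 0 + u1 * q 0 1 + u2 * q 0 2)
     - q 0 2 * (u0 * p 0 0 + u1 * p 0 1 + u2 * p 0 2)).
    by rewrite /wedge0 /wedge1; ring.
  by rewrite hp hq !mulr0 subr0.
have c0 : u1 * wedge2 p q = u2 * wedge1 p q.
  apply/eqP; rewrite -subr_eq0; apply/eqP.
  transitivity (p 0 0 * (u0 * q 0 0 + u1 * q 0 1 + u2 * q 0 2)
     - q 0 0 * (u0 * p 0 0 + u1 * p 0 1 + u2 * p 0 2)).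
    by rewrite /wedge2 /wedge1; ring.
  by rewrite hp hq !mulr0 subr0.
have c1 : u2 * wedge0 p q = u0 * wedge2 p q.
  apply/eqP; rewrite -subr_eq0; apply/eqP.
  transitivity (p 0 1 * (u0 * q 0 0 + u1 * q 0 1 + u2 * q 0 2)
     - q 0 1 * (u0 * p 0 0 + u1 * p 0 1 + u2 * p 0 2)).
    by rewrite /wedge2 /wedge0; ring.
  by rewrite hp hq !mulr0 subr0.
case: w0 => [w1|w2].
  apply: (mulfI w1); rewrite mulr0 -[RHS](mulr0 u1) -hz.
  transitivity (u0 * wedge1 p q * z 0 0 + u1 * wedge1 p q * z 0 1 + u2 * wedge1 p q * z 0 2); first ring.
  by rewrite c2 -c0; ring.
apply: (mulfI w2); rewrite mulr0 -[RHS](mulr0 u2) -hz.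
transitivity (u0 * wedge2 p q * z 0 0 + u1 * wedge2 p q * z 0 1 + u2 * wedge2 p q * z 0 2); first ring.
by rewrite c0 -c1; ring.
Qed.

Section Sequence.
Variables (R : realType) (xi : R) (x : nat -> 'rV[int]_3).
Hypothesis hx : minimal_points xi x.

Let pt i := real_pt R (x i).

Lemma minimal_wedge_neq0 i k : (0 < i)%N -> (i < k)%N ->
  wedge1 (pt i) (pt k) != 0 \/ wedge2 (pt i) (pt k) != 0.
Proof.
move=> i0 ik; have [w1|] := eqVneq (wedge1 (pt i) (pt k)) 0; last by left.
right; apply/negP => /eqP w2; apply: (minimal_wedge hx i0 ik).
  by move/eqP: w2; rewrite /wedge2 subr_eq0 /pt !real_ptE => /eqP.
by move/eqP: w1; rewrite /wedge1 subr_eq0 /pt !real_ptE => /eqP.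
Qed.

(** An index strictly between i and j is not in I, so three consecutive minimal
    points in this range are dependent, and each new point stays in the plane
    of the two previous ones. *)
Lemma coplanar_until_succ i j : (0 < i)%N -> succ_in (setI3 R x) i j ->
  triple (pt i) (pt i.+1) (pt j) = 0.
Proof.
move=> i0 [_ _ ij hj].
suff H k : (i <= k)%N -> (k < j)%N ->
    triple (pt i) (pt i.+1) (pt k) = 0 /\ triple (pt i) (pt i.+1) (pt k.+1) = 0.
  by case: j ij hj H => // j ij _ H; have [] := H j ij (ltnSn j).
elim: k => [|k IH]; first by move: i0; case: (i).
rewrite leq_eqVlt => /orP[/eqP <- _|ik kj].
  by split; rewrite /triple /wedge0 /wedge1 /wedge2; ring.
have [hk hk1] := IH ik (ltnW kj); split=> //.
apply: (coplanar_trans (p := pt k) (q := pt k.+1)) => //.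
  by apply: minimal_wedge_neq0 => //; exact: leq_trans i0 ik.
apply/eqP; apply: contraT => t0.
suff : (j <= k.+1)%N by rewrite leqNgt kj.
apply: hj; last by rewrite ltnS.
by split; [rewrite ltnS; exact: leq_trans i0 ik|exact: free_of_triple].
Qed.

End Sequence.

(** * Finiteness of the set of common zeros *)

Section MapForms.
Variables (K S : comNzRingType) (f : {rmorphism K -> S}).
Implicit Types x y : 'rV[K]_3.

Lemma map_phi x : phi (map_mx f x) = f (phi x).
Proof. by rewrite /phi !mxE rmorphB rmorphM !rmorphXn. Qed.

Lemma map_Phi x y z : Phi (map_mx f x) (map_mx f y) (map_mx f z) = f (Phi x y z).
Proof. by rewrite /Phi !mxE rmorphB !rmorphD !rmorphM rmorph_nat. Qed.

Lemma map_formF x y : formF (map_mx f x) (map_mx f y) = f (formF x y).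
Proof.
by rewrite /formF /formT /formS /formU !map_Phi map_phi [RHS]rmorphB rmorphXn 2!rmorphM rmorph_nat.
Qed.
End MapForms.

Lemma map_wedge (R : realType) (x y : 'rV[int]_3) :
  [/\ wedge0 (real_pt R x) (real_pt R y) = (wedge0 x y)%:~R,
      wedge1 (real_pt R x) (real_pt R y) = (wedge1 x y)%:~R &
      wedge2 (real_pt R x) (real_pt R y) = (wedge2 x y)%:~R].
Proof. by rewrite /wedge0 /wedge1 /wedge2 !mxE !rmorphB !rmorphM. Qed.

(** The quantities S^2 disc and H^3 are weighted homogeneous of weight 6 in
    (T, F, S^2 V), by the identity SU = (T^2 - F) / 4. *)
Lemma common_zero_bounds (R : realType) (P Q : ringR) :
  homogeneousR P -> homogeneousR Q -> relprimeR P Q ->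
  exists2 k : R, 0 < k & forall x y : 'rV[int]_3,
    evalR P x y = 0 -> evalR Q x y = 0 -> phi x != 0 -> phi y != 0 ->
    let x' := real_pt R x in let y' := real_pt R y in
    let S := formS x' y' in let T := formT x' y' in
    let U := formU x' y' in let V := formV x' y' in
    let D := cubic_disc S T U V in let H := hessian S T U in
    [/\ k * T ^+ 6 <= (S ^+ 2 * V) ^+ 2,
        S ^+ 2 * D = 0 \/ k * (S ^+ 2 * V) ^+ 2 <= `|S ^+ 2 * D| &
        H ^+ 3 = 0 \/ k * (S ^+ 2 * V) ^+ 2 <= `|H ^+ 3|].
Proof.
move=> hP hQ cop.
pose N1 (T F G : R) := cubic_disc 1 T ((T ^+ 2 - F) / 4) G.
pose N2 (T F G : R) := hessian 1 T ((T ^+ 2 - F) / 4) ^+ 3.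
have [|k1 k10 h1] := @weight6_bound R P Q N1 hP hQ cop.
  by move=> t a b c; rewrite /N1 /cubic_disc; field.
have [|k2 k20 h2] := @weight6_bound R P Q N2 hP hQ cop.
  by move=> t a b c; rewrite /N2 /hessian; field.
exists (Num.min k1 k2) => [|x y Px Qx phix phiy x' y' S T U V D H].
  by rewrite lt_min k10 k20.
pose xq := map_mx intr x : 'rV[rat]_3; pose yq := map_mx intr y : 'rV[rat]_3.
pose w := tnth [tuple formT xq yq; formF xq yq; formS xq yq ^+ 2 * formV xq yq].
have SE : S = (phi x)%:~R by rewrite /S /formS map_phi.
have VE : V = (phi y)%:~R by rewrite /V /formV map_phi.
have w0E : ratr (w 0) = T.
  by rewrite /w (tnth_nth 0) /= /T /formT !map_Phi ratr_int.
have w1E : ratr (w 1) = T ^+ 2 - 4 * S * U.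
  by rewrite /w (tnth_nth 0) /= map_formF ratr_int -(map_formF intr).
have w2E : ratr (w 2) = S ^+ 2 * V.
  rewrite /w (tnth_nth 0) /= /formS /formV !map_phi rmorphM rmorphXn /= !ratr_int.
  by rewrite SE VE.
have w2 : w 2 != 0.
  rewrite -(fmorph_eq0 (ratr : {rmorphism rat -> R})) /= w2E SE VE.
  by rewrite mulf_neq0 ?expf_neq0 ?intr_eq0.
have [] := h1 w Px Qx w2; have [] := h2 w Px Qx w2.
rewrite w0E w1E w2E.
have -> : N1 T (T ^+ 2 - 4 * S * U) (S ^+ 2 * V) = S ^+ 2 * D.
  by rewrite /N1 /D /cubic_disc; field.
have -> : N2 T (T ^+ 2 - 4 * S * U) (S ^+ 2 * V) = H ^+ 3.
  by rewrite /N2 /H /hessian; field.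
have m1 (A : R) : 0 <= A -> Num.min k1 k2 * A <= k1 * A.
  by move=> A0; rewrite ler_wpM2r // ge_min lexx.
have m2 (A : R) : 0 <= A -> Num.min k1 k2 * A <= k2 * A.
  by move=> A0; rewrite ler_wpM2r // ge_min lexx orbT.
have T6 : 0 <= T ^+ 6 by rewrite (exprM T 3 2) sqr_ge0.
move=> hh _ hd ht; split.
- by apply: le_trans ht; apply: m1.
- by case: hd => [->|hd]; [left|right; apply: le_trans hd; apply: m1; rewrite sqr_ge0].
- by case: hh => [->|hh]; [left|right; apply: le_trans hh; apply: m2; rewrite sqr_ge0].
Qed.

(** The bounds without the factor X^2 follow as X >= 1, after cubing. *)
Lemma small_products (R : realFieldType) (M X L : R) : 1 <= M -> 1 <= X -> 0 <= L ->
  M ^+ 3 * (X ^+ 2 * L ^+ 3) < 1 ->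
  [/\ M * (X ^+ 2 * L ^+ 3) < 1, M * (X * L ^+ 2) < 1 & M * L < 1].
Proof.
move=> M1 X1 L0 h.
have M0 : 0 <= M by lra.
have X0 : 0 <= X by lra.
have cube (A : R) : 0 <= A -> A ^+ 3 < 1 -> A < 1.
  by move=> A0; rewrite !ltNge; apply: contra; exact: exprn_ege1.
have E0 : 0 <= X ^+ 2 * L ^+ 3 by rewrite mulr_ge0 ?exprn_ge0.
have M3 : M <= M ^+ 3 by rewrite exprS ler_peMr // exprn_ege1.
have ML : (M * L) ^+ 3 < 1.
  apply: le_lt_trans h; rewrite exprMn ler_wpM2l ?exprn_ge0 //.
  by rewrite ler_peMl ?exprn_ge0 // exprn_ege1.
have ML1 : M * L < 1 by apply: cube ML; rewrite mulr_ge0.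
split => //; first by apply: le_lt_trans h; rewrite ler_wpM2r.
apply: cube; first by rewrite !mulr_ge0 ?exprn_ge0.
apply: le_lt_trans (h).
have -> : (M * (X * L ^+ 2)) ^+ 3 = M ^+ 3 * (X ^+ 2 * L ^+ 3) * (X * L ^+ 3) by ring.
have XL : X * L ^+ 3 <= 1.
  apply: le_trans (_ : M ^+ 3 * (X ^+ 2 * L ^+ 3) <= 1); last exact: ltW.
  apply: le_trans (_ : X ^+ 2 * L ^+ 3 <= _).
    by rewrite ler_wpM2r ?exprn_ge0 // expr2 ler_peMl.
  by rewrite ler_peMl // exprn_ege1.
by rewrite ler_piMr // mulr_ge0 // exprn_ge0.
Qed.

(** The discriminant vanishes by [degenerate_forms]; the normal vector of the
    plane is then in one of the two special positions, and a point of too small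
    height and error is found on the curve. *)
Lemma no_common_zero (R : realType) (xi k : R) : 0 < k -> xi != 0 ->
  exists2 M : R, 1 <= M & forall (x : nat -> 'rV[int]_3) (i j : nat),
    minimal_points xi x -> (0 < i)%N -> succ_in (setI3 R x) i j ->
    phi (x i) != 0 ->
    M ^+ 3 * (supnorm (real_pt R (x i.+1)) ^+ 2 * Lxi xi (real_pt R (x i)) ^+ 3) < 1 ->
    let x' := real_pt R (x i) in let y' := real_pt R (x j) in
    let S := formS x' y' in let T := formT x' y' in
    let U := formU x' y' in let V := formV x' y' in
    let D := cubic_disc S T U V in let H := hessian S T U in
    k * T ^+ 6 <= (S ^+ 2 * V) ^+ 2 ->
    S ^+ 2 * D = 0 \/ k * (S ^+ 2 * V) ^+ 2 <= `|S ^+ 2 * D| ->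
    H ^+ 3 = 0 \/ k * (S ^+ 2 * V) ^+ 2 <= `|H ^+ 3| -> False.
Proof.
move=> k0 xi0.
have [C1 [c [C10 c0 hdeg]]] := degenerate_forms xi k0.
have [C2 C20 hfar] := tangent_far c0 xi0.
have [W W0 hW] := wedge_bounds xi.
have nxi : 0 < `|xi| by rewrite normr_gt0.
have ixi3 : 0 < (`|xi| ^+ 3)^-1 by rewrite invr_gt0 exprn_gt0.
pose A1 : R := W ^+ 3.
pose A2 : R := W ^+ 2 * (1 + `|xi| + `|xi| ^+ 2) * 2.
pose A3 : R := 4 * W ^+ 2.
pose A4 : R := (16 / `|xi| ^+ 2 + 76) * W * 2.
have A10 : 0 <= A1 by rewrite exprn_ge0 // ltW.
have q0 : 0 <= 1 + `|xi| + `|xi| ^+ 2 by rewrite !addr_ge0 ?exprn_ge0.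
have Wp := ltW W0.
have A20 : 0 <= A2 by rewrite /A2 !mulr_ge0 ?q0.
have A30 : 0 <= A3 by rewrite /A3 mulr_ge0 ?sqr_ge0.
have A40 : 0 <= A4.
  by rewrite /A4 !mulr_ge0 ?(ltW W0) // addr_ge0 // divr_ge0 // exprn_ge0.
pose M : R := 1 + C1 + C2 + (`|xi| ^+ 3)^-1 + A1 + A2 + A3 + A4.
have [M1 [MC1 MC2] [Mxi MA1 MA2] [MA3 MA4]] : [/\ 1 <= M, C1 <= M /\ C2 <= M,
   [/\ (`|xi| ^+ 3)^-1 <= M, A1 <= M & A2 <= M] & A3 <= M /\ A4 <= M].
  rewrite /M; move: C10 C20 ixi3 A10 A20 A30 A40; clear.
  move: (_^-1) A1 A2 A3 A4 => a1 a2 a3 a4 a5 *; split; [lra|split; lra|split; lra|split; lra].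
exists M => // x i j hx i0 hj phi0 small x' y' S T U V D H hT hD hH.
have [_ _ ij _] := hj.
have j0 : (0 < j)%N by apply: leq_trans ij.
pose X := supnorm (real_pt R (x i)); pose X1 := supnorm (real_pt R (x i.+1)).
pose L := Lxi xi (real_pt R (x i)); pose L1 := Lxi xi (real_pt R (x i.+1)).
have L0 : 0 < L := minimal_error_gt0 hx i0.
have L10 : 0 < L1 := minimal_error_gt0 hx (ltn0Sn i).
have LL1 : L1 < L := minimal_error_lt hx i0 (ltnSn i).
have Lone : L < 1 := minimal_error_lt1 hx i0.
have X1one : 1 <= X1.
  by apply: le_trans (minimal_height_ge hx (ltn0Sn i)); rewrite ler1n.
have Xone : 1 <= X by apply: le_trans (minimal_height_ge hx i0); rewrite ler1n.
have XX1 : X <= X1 := ltW (minimal_height_lt hx i0 (ltnSn i)).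
have XXj : X <= supnorm (real_pt R (x j)) := ltW (minimal_height_lt hx i0 ij).
have LLj : Lxi xi (real_pt R (x j)) <= L := ltW (minimal_error_lt hx i0 ij).
have xi_n := minimal_neq0 hx i0; have xj_n := minimal_neq0 hx j0.
have [s1 s2 s3] := small_products M1 X1one (ltW L0) small.
rewrite -/X1 -/L in s1 s2 s3.
have X1p : 0 < X1 := lt_le_trans ltr01 X1one.
have E1 : 0 <= X1 ^+ 2 * L ^+ 3 by apply: mulr_ge0; apply: exprn_ge0; exact: ltW.
have E2 : 0 <= X1 * L ^+ 2 by apply: mulr_ge0; [exact: ltW|exact: sqr_ge0].
have b1 A : A <= M -> A * (X1 ^+ 2 * L ^+ 3) < 1.
  by move=> h; apply: le_lt_trans s1; rewrite ler_wpM2r.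
have b2 A : A <= M -> A * (X1 * L ^+ 2) < 1.
  by move=> h; apply: le_lt_trans s2; rewrite ler_wpM2r.
have b2' A : 0 <= A -> A <= M -> A * (X * L ^+ 2) < 1.
  move=> A0 h; apply: le_lt_trans (b2 A h); rewrite ler_wpM2l // ler_wpM2r //.
  by rewrite sqr_ge0.
have b3 A : A <= M -> A * L < 1.
  by move=> h; apply: le_lt_trans s3; rewrite ler_wpM2r // ltW.
have [D0 Hc] := hdeg (x i) (x j) xi_n xj_n Lone LLj XXj (b2' _ (ltW C10) MC1) phi0 hT hD hH.
pose a := wedge0 (x i) (x i.+1); pose b := wedge1 (x i) (x i.+1); pose g := wedge2 (x i) (x i.+1).
have [aE bE gE] := map_wedge R (x i) (x i.+1).
have [wa wb wg wN] := hW (x i) (x i.+1) XX1 (ltW LL1) (le_trans (ltW Lone) X1one).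
rewrite -/a -/b -/g -/X1 -/L -/L1 in aE bE gE wa wb wg wN.
have tri := coplanar_until_succ hx i0 hj.
rewrite /triple aE bE gE -/x' -/y' in tri.
have trii : a%:~R * x' 0 0 + b%:~R * x' 0 1 + g%:~R * x' 0 2 = 0 :> R.
  by rewrite -aE -bE -gE /wedge0 /wedge1 /wedge2; ring.
have wij := minimal_wedge_neq0 hx i0 ij; rewrite -/x' -/y' in wij.
have bg0 := minimal_wedge_neq0 hx i0 (ltnSn i); rewrite bE gE in bg0.
have contra_point : (exists2 z : 'rV[int]_3, z != 0 &
    Lxi xi (real_pt R z) < L /\ supnorm (real_pt R z) < X1) -> False.
  by move=> [z z0 [zL zX]]; exact: (minimal_contra hx i0 z0 zL zX).
have [g0|g0] := eqVneq g 0.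
  have b0 : b != 0.
    by case: bg0; rewrite ?g0 ?eqxx // intr_eq0.
  apply: contra_point.
  apply: (@cusp_line_point R xi a b (W * (X1 * L)) (2 * (L * L1)) L X1 b0 wa wb).
  - by move: wN; rewrite g0 mul0r addr0.
  - have -> : (W * (X1 * L)) ^+ 3 = A1 * (X1 ^+ 2 * L ^+ 3) * X1 by rewrite /A1; ring.
    by rewrite (gtr_pMl _ X1p); exact: b1.
  - have -> : (W * (X1 * L)) ^+ 2 * (1 + `|xi| + `|xi| ^+ 2) * (2 * (L * L1)) =
      A2 * (X1 ^+ 2 * L ^+ 3) * L1 by rewrite /A2; ring.
    by apply: lt_trans LL1; rewrite gtr_pMl //; exact: b1.
(* The normal vectors from (x_i, x_(i+1)) and from (x_i, x_j) are parallel. *)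
have par1 : b%:~R * wedge2 x' y' = g%:~R * wedge1 x' y' :> R.
  apply/eqP; rewrite -subr_eq0; apply/eqP.
  transitivity (x' 0 0 * (a%:~R * y' 0 0 + b%:~R * y' 0 1 + g%:~R * y' 0 2)
     - y' 0 0 * (a%:~R * x' 0 0 + b%:~R * x' 0 1 + g%:~R * x' 0 2)).
    by rewrite /wedge1 /wedge2; ring.
  by rewrite tri trii !mulr0 subr0.
have par0 : a%:~R * wedge2 x' y' = g%:~R * wedge0 x' y' :> R.
  apply/eqP; rewrite -subr_eq0; apply/eqP.
  transitivity (y' 0 1 * (a%:~R * x' 0 0 + b%:~R * x' 0 1 + g%:~R * x' 0 2)
     - x' 0 1 * (a%:~R * y' 0 0 + b%:~R * y' 0 1 + g%:~R * y' 0 2)).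
    by rewrite /wedge0 /wedge2; ring.
  by rewrite tri trii !mulr0 subr0.
have gR : g%:~R != 0 :> R by rewrite intr_eq0.
have w2 : wedge2 x' y' != 0.
  case: wij => // w1; apply: contraNneq w1 => w2.
  by apply/eqP/(mulfI gR); rewrite -par1 w2 !mulr0.
have tang : 4 * b%:~R ^+ 3 + 27 * a%:~R ^+ 2 * g%:~R = 0 :> R.
  move: D0; rewrite /D cubic_disc_wedge => /eqP.
  rewrite oppr_eq0 mulf_eq0 expf_eq0 /= (negPf w2) /= => /eqP dual.
  apply: (mulfI (expf_neq0 3 w2)); rewrite mulr0 -[RHS](mulr0 (g%:~R ^+ 3)) -dual.
  transitivity (4 * (b%:~R * wedge2 x' y') ^+ 3 + 27 * (a%:~R * wedge2 x' y') ^+ 2 * (g%:~R * wedge2 x' y')).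
    by ring.
  by rewrite par1 par0; ring.
have b0 : b != 0.
  apply/negP => /eqP b0; move: tang; rewrite b0 expr0n mulr0 add0r => /eqP.
  rewrite mulf_eq0 (negPf gR) orbF mulf_eq0 expf_eq0 pnatr_eq0 /= => /eqP a0.
  move: trii; rewrite b0 a0 !mul0r !add0r => /eqP; rewrite mulf_eq0 (negPf gR) /= => /eqP x20.
  have : `|xi| ^+ 3 <= L.
    have : Lxi xi x' <= L by [].
    rewrite Lxi_le => /andP[_]; rewrite -!real_ptE -/x' x20 sub0r normrN normrM normrX.
    apply: le_trans; rewrite ler_peMl ?exprn_ge0 // /x' real_ptE; apply: norm_int_ge1.
    by have := rcoord0_neq0 xi_n Lone; rewrite intr_eq0.
  have := b3 _ Mxi; rewrite mulrC ltr_pdivrMr ?exprn_gt0 // mul1r => h1 h2.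
  by have := lt_le_trans h1 h2; rewrite ltxx.
have bR : b%:~R != 0 :> R by rewrite intr_eq0.
(* The double root of g t^3 + b t + a. *)
have [r rE] : exists r : R, r = - (3 * a%:~R) / (2 * b%:~R) by eexists.
have tang' : 27 * a%:~R ^+ 2 * g%:~R = - (4 * b%:~R ^+ 3) :> R.
  by apply/eqP; rewrite -subr_eq0 opprK addrC tang.
have br : b%:~R = - (3 * r ^+ 2 * g%:~R) :> R.
  transitivity (- (27 * a%:~R ^+ 2 * g%:~R) / (4 * b%:~R ^+ 2) : R); last by rewrite rE; field.
  by rewrite tang'; field.
have ar : a%:~R = 2 * r ^+ 3 * g%:~R :> R.
  transitivity (- (27 * a%:~R ^+ 2 * g%:~R) * a%:~R / (4 * b%:~R ^+ 3) : R); last by rewrite rE; field.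
  by rewrite tang'; field.
have plane (z : 'rV[R]_3) : a%:~R * z 0 0 + b%:~R * z 0 1 + g%:~R * z 0 2 = 0 ->
    z 0 2 = 3 * r ^+ 2 * z 0 1 - 2 * r ^+ 3 * z 0 0.
  rewrite ar br => hz; apply: (mulfI gR); apply/eqP; rewrite -subr_eq0 -[X in _ == X]hz.
  by apply/eqP; ring.
have xr := plane _ trii; have yr := plane _ tri.
have phix : phi x' != 0 by rewrite map_phi intr_eq0.
have far : `|xi| <= 4 * `|xi - r|.
  apply: (hfar (x i) (x j) r) => //; [exact: b2' (ltW C20) MC2|exact: b3|].
  case: Hc => // H0; move: H0; rewrite /H (tangent_hessian xr yr) => /eqP.
  rewrite expf_eq0 /= !mulf_eq0 (negPf w2) orbF pnatr_eq0 /= => /orP[/eqP r0|/eqP h0].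
    by case/negP: bR; rewrite br r0 expr0n mulr0 mul0r oppr0.
  by case/negP: phix; rewrite (tangent_phi xr) h0 expr0n mul0r oppr0.
apply: contra_point.
apply: (@tangent_line_point R xi a b g r (W * (X1 * L)) (2 * (L * L1)) L X1 b0 g0) => //.
- have -> : 4 * (W * (X1 * L)) ^+ 2 = A3 * (X1 * L ^+ 2) * X1 by rewrite /A3; ring.
  by rewrite (gtr_pMl _ X1p); exact: b2.
- have -> : (16 / `|xi| ^+ 2 + 76) * (W * (X1 * L) * (2 * (L * L1))) =
      A4 * (X1 * L ^+ 2) * L1 by rewrite /A4; ring.
  by apply: lt_trans LL1; rewrite gtr_pMl //; exact: b2.
Qed.

Theorem proposition4p13 (R : realType) (xi : R)
    (hxi : linindep_1_xi_xi3 xi)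
    (lambda c : R) (hlambda : 0 < lambda) (hc : 0 < c)
    (happrox : uniform_approx xi lambda c)
    (x : nat -> 'rV[int]_3) (hx : minimal_points xi x)
    (hlambda23 : 2 / 3 < lambda)
    (P Q : {mpoly rat[3]}) (hP : homogeneousR P) (hQ : homogeneousR Q)
    (hPQ : relprimeR P Q) :
  finite_set [set i : nat | exists j : nat,
    [/\ succ_in (setI3 R x) i j,
        evalR P (x i) (x j) = 0 & evalR Q (x i) (x j) = 0]]%classic.
Proof.
have xi0 : xi != 0.
  apply/negP => /eqP xi0; have [] := hxi 0 1 0; last by move=> _ /eqP; rewrite oner_eq0.
  by rewrite xi0 !rmorph0 rmorph1 mul0r mulr0 !addr0.
have [k k0 hk] := common_zero_bounds R hP hQ hPQ.
have [M M1 hM] := no_common_zero k0 xi0.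
have [C C0 hC] := phi_neq0_of_prev xi.
have M3 : 0 < M ^+ 3 by rewrite exprn_gt0 //; lra.
have eta0 : 0 < (M ^+ 3 + C)^-1 by rewrite invr_gt0 addr_gt0.
have [N hN] := small_eventually hx hc happrox hlambda23 eta0.
have small i A : (N <= i)%N -> A <= M ^+ 3 + C ->
    A * (supnorm (real_pt R (x i.+1)) ^+ 2 * Lxi xi (real_pt R (x i)) ^+ 3) < 1.
  move=> Ni AM; have [i0 h] := hN i Ni.
  have E0 : 0 <= supnorm (real_pt R (x i.+1)) ^+ 2 * Lxi xi (real_pt R (x i)) ^+ 3.
    by rewrite mulr_ge0 ?sqr_ge0 // exprn_ge0 // Lxi_ge0.
  apply: le_lt_trans (_ : (M ^+ 3 + C) *
    (supnorm (real_pt R (x i.+1)) ^+ 2 * Lxi xi (real_pt R (x i)) ^+ 3) < 1).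
    by rewrite ler_wpM2r.
  by rewrite mulrC -ltr_pdivlMr ?addr_gt0 // mul1r.
have phi_neq0 i : (N < i)%N -> phi (x i) != 0.
  case: i => // i Ni; have [i0 _] := hN i Ni.
  apply/negP => /eqP phi0.
  have [||||h1 h2] := hC (x i.+1) (x i) (minimal_neq0 hx (ltn0Sn i)) _ _ _ _ phi0.
  - by apply/ltW/(minimal_error_lt hx).
  - exact: (minimal_error_lt1 hx).
  - by apply/ltW/(minimal_height_lt hx).
  - by apply: small => //; rewrite lerDr ltW.
  - exact: (minimal_wedge hx i0 (ltnSn i) h1 h2).
apply: (sub_finite_set _ (finite_II N.+1)) => i [j [hj Pz Qz]] /=.
rewrite ltnS leqNgt; apply/negP => Ni.
have [_ _ ij _] := hj.
have phii := phi_neq0 i Ni; have phij := phi_neq0 j (ltn_trans Ni ij).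
have [hT hD hH] := hk (x i) (x j) Pz Qz phii phij.
apply: (hM x i j hx (leq_trans (ltn0Sn N) Ni) hj phii _ hT hD hH).
by apply: small; [exact: ltnW|rewrite lerDl ltW].
Qed.
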